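(* Let $\omega=(w_1,\dots,w_m)\in\Delta_m$ and $\mathbb{A}=(A_1,\dots,A_m)\in\mathbb{P}_n^m$. Then: (1) $\Gamma(\omega;\mathbb{A})\supseteq\{A_1^{w_1}A_2^{w_2}\cdots A_m^{w_m}\}$ if the $A_i$'s commute; (2) $\Gamma(\omega;\alpha\mathbb{A})=\alpha\,\Gamma(\omega;\mathbb{A})$ for any $\alpha>0$; (3) $\Gamma(\omega_\sigma;\mathbb{A}_\sigma)=\Gamma(\omega;\mathbb{A})$ for any permutation $\sigma$ of $\{1,\dots,m\}$; (4) $\Gamma(\omega^k;\mathbb{A}^k)=\Gamma(\omega;\mathbb{A})$ for any $k\in\mathbb{N}$; (5) $\Gamma(\omega;U\mathbb{A}U^* )=U\,\Gamma(\omega;\mathbb{A})\,U^*$ for any unitary matrix $U$; (6) $\Gamma(\omega;\mathbb{A}^{-1})=\{X^{-1}:X\in\Gamma(\omega;\mathbb{A})\}$; (7) $\{\det X: X\in\Gamma(\omega;\mathbb{A})\}=\{(\det A_1)^{w_1}(\det A_2)^{w_2}\cdots(\det A_m)^{w_m}\}$.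
   Context: $\mathbb{P}_n$ is the set of $n\times n$ complex positive definite matrices; $\Delta_m$ is the set of $\omega=(w_1,\dots,w_m)$ with $w_i>0$ and $\sum_i w_i=1$. $A\sharp B=A^{1/2}(A^{-1/2}BA^{-1/2})^{1/2}A^{1/2}$. The Karcher mean $\Lambda(\omega;A_1,\dots,A_m)$ is the unique $X\in\mathbb{P}_n$ with $\sum_i w_i\log(X^{-1/2}A_iX^{-1/2})=0$. Define $$\Gamma(\omega;\mathbb{A})=\{X\in\mathbb{P}_n:\Lambda(\omega;A_1\sharp X^{-1},\dots,A_m\sharp X^{-1})=I\},$$ equivalently the set of $X\in\mathbb{P}_n$ with $\sum_i w_i\log(A_i\sharp X^{-1})=0$. Notation: $\alpha\mathbb{A}=(\alpha A_1,\dots,\alpha A_m)$, $U\mathbb{A}U^*=(UA_1U^*,\dots,UA_mU^* )$, $\mathbb{A}^{-1}=(A_1^{-1},\dots,A_m^{-1})$, $\omega_\sigma=(w_{\sigma(1)},\dots,w_{\sigma(m)})$, $\mathbb{A}_\sigma=(A_{\sigma(1)},\dots,A_{\sigma(m)})$. For $k\in\mathbb{N}$ ($k\ge1$), $\omega^k=\frac1k(w_1,\dots,w_m,\dots,w_1,\dots,w_m)\in\Delta_{mk}$ and $\mathbb{A}^k=(A_1,\dots,A_m,\dots,A_1,\dots,A_m)\in\mathbb{P}_n^{mk}$ ($k$ repetitions of the block). For a set $\Gamma$ of matrices, $c\,\Gamma=\{cX:X\in\Gamma\}$ and $U\Gamma U^*=\{UXU^*:X\in\Gamma\}$. *)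

(* Defs.v *)
From HB Require Import structures.
From mathcomp Require Import all_boot all_order all_algebra all_fingroup.
From mathcomp Require Import complex.
From mathcomp Require Import boolp classical_sets reals exp.

Set Implicit Arguments.
Unset Strict Implicit.
Unset Printing Implicit Defensive.

Import Order.TTheory GRing.Theory Num.Theory.
Local Open Scope ring_scope.
Local Open Scope complex_scope.
Local Open Scope sesquilinear_scope.
Local Open Scope classical_set_scope.

(* On R[i], 0 < z means that z is real and positive. *)
Definition posdefmx (R : realType) (n : nat) : set 'M[R[i]]_n :=
  [set A | A \is hermsymmx /\
           forall x : 'cV[R[i]]_n, x != 0 -> 0 < (x ^t* *m A *m x) 0 0].

(* Functional calculus: a Hermitian A equals P^-1 *m diag_mx d *m P with
   P = spectralmx A unitary and d = spectral_diag A real; f is applied to d. *)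
Definition mxfun (R : realType) (n : nat) (f : R -> R) (A : 'M[R[i]]_n) :
    'M[R[i]]_n :=
  invmx (spectralmx A)
    *m diag_mx (map_mx (fun z : R[i] => (f (complex.Re z))%:C) (spectral_diag A))
    *m spectralmx A.

Definition mxlog (R : realType) (n : nat) (A : 'M[R[i]]_n) : 'M[R[i]]_n :=
  mxfun (@ln R) A.

Definition mxpow (R : realType) (n : nat) (A : 'M[R[i]]_n) (t : R) :
    'M[R[i]]_n :=
  mxfun (fun x : R => x `^ t) A.

Definition geomean (R : realType) (n : nat) (A B : 'M[R[i]]_n) : 'M[R[i]]_n :=
  let Ah := mxpow A 2^-1 in
  let Amh := mxpow A (- 2^-1) in
  Ah *m mxpow (Amh *m B *m Amh) 2^-1 *m Ah.

Definition prob_weights (R : realType) (m : nat) (w : 'I_m -> R) : Prop :=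
  (forall i, 0 < w i) /\ \sum_(i < m) w i = 1.

(* The graph of the Karcher mean: X is the mean of A with weights w.  For
   positive definite A i and w in the open simplex, such an X exists and is
   unique. *)
Definition is_karcher_mean (R : realType) (n m : nat) (w : 'I_m -> R)
    (A : 'I_m -> 'M[R[i]]_n) (X : 'M[R[i]]_n) : Prop :=
  posdefmx X /\
  \sum_(i < m) (w i)%:C *:
     mxlog (mxpow X (- 2^-1) *m A i *m mxpow X (- 2^-1)) = 0.

Definition Gamma (R : realType) (n m : nat) (w : 'I_m -> R)
    (A : 'I_m -> 'M[R[i]]_n) : set 'M[R[i]]_n :=
  [set X | posdefmx X /\
           is_karcher_mean w (fun i => geomean (A i) (invmx X)) 1%:M].

Lemma block_index_subproof (k m : nat) (i : 'I_(m * k)) : (i %% m < m)%N.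
Proof. by case: m i => [[]|m i] //; rewrite ltn_mod. Qed.

(* Position inside its block of an index of the k-fold repetition of an
   m-tuple. *)
Definition block_index (k m : nat) (i : 'I_(m * k)) : 'I_m :=
  Ordinal (block_index_subproof i).

Definition repeat_weights (R : realType) (m k : nat) (w : 'I_m -> R) :
    'I_(m * k) -> R :=
  fun i => k%:R^-1 * w (block_index i).

Definition repeat_tuple (T : Type) (m k : nat) (A : 'I_m -> T) :
    'I_(m * k) -> T :=
  fun i => A (block_index i).

(* Main.v *)
Require Import Defs.
From HB Require Import structures.
From mathcomp Require Import all_boot all_order all_algebra all_fingroup.
From mathcomp Require Import complex.
From mathcomp Require Import boolp classical_sets reals topology normedtype.
From mathcomp Require Import sequences derive exp.
From mathcomp Require Import ring lra zify.

(** Everything rests on one description of the geometric mean: for positive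
definite [A] and [X], the matrix [geomean A (invmx X)] is the only positive
definite solution [T] of the Riccati equation [T X T = A] ([geomean_riccati],
[geomeanE]).  Membership of [X] in [Gamma w A] therefore says that the solutions
[T i] of [T i X T i = A i] satisfy [sum w i log (T i) = 0] ([GammaE]).

Scaling [A] and [X] together leaves [T] unchanged, a unitary change of basis
conjugates it, and inverting [A] and [X] inverts [T], which changes the sign of
the logarithm.  For commuting [A i], a common unitary eigenbasis
([codiagonalization]) reduces the equation to real numbers.  Taking traces, and
using that the trace of [log T] is the logarithm of [det T], the equation gives
[prod (det (T i)) ^ (w i) = 1]; as [det (A i) = (det (T i))^2 det X], the
determinant of [X] is forced ([Gamma_det]).

The determinant formula is an equality of sets, so it also says that [Gamma w A]
is not empty ([Gamma_nonempty]).  Write the inverse of [X] as [exp G] with [G]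
hermitian and let [F G = sum w i log (geomean (A i) (exp G))].  The map [F] is
not known to be monotone or to be a gradient, and a topological argument is
used.  In an eigenbasis of [G], the diagonal entries of [F G] differ from half
the eigenvalues of [G] by at most a constant ([logsum_coercive]): the upper
estimate is Jensen's inequality for the logarithm together with the diagonal
entries of the Riccati equation, and the lower one follows by passing to
inverses.  Hence [tr (F G * G) <= 0] bounds [G] ([logsum_bounded]).

Let [G] range over the convex hull of finitely many hermitian matrices, the
vertices, closed under [V |-> - V].  A fixed-point argument on the simplex of
barycentric coordinates ([simplex_variational]) gives a [G] with
[tr (F G * (G - V)) <= 0] for every vertex [V].  Applied to [V] and [- V] this
bounds the size of [tr (F G * V)] by [- tr (F G * G)]; so [G] is bounded
independently of the vertices, and when these are large multiples of a real
basis of the hermitian matrices, all coordinates of [F G] are too small compared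
with [F G] itself unless [F G = 0].

The fixed-point argument is Scarf's: the points of a fine grid in the simplex,
ordered by each coordinate in turn and coloured by the sign of a component of
the map, contain a dominant set that meets all the needed colours ([scarf]).
Such a set has small diameter ([near_colours]), and compactness of the simplex
turns the resulting approximate zeros into an exact one ([simplex_zero]).  It
applies because [F] is Lipschitz on bounded sets: between eigenbases of two
hermitian matrices [A] and [B], the entries of [f A - f B] are those of [A - B]
multiplied by difference quotients of [f] ([udiag_entry], [l1norm_udiagB]). *)

Set Implicit Arguments.
Unset Strict Implicit.
Unset Printing Implicit Defensive.

Import Order.TTheory GRing.Theory Num.Theory.

(** * Scarf's lemma on dominant sets *)
Section Scarf.
Local Open Scope nat_scope.
Variables (W I : finType) (r : I -> W -> nat) (slack : I -> W) (c : W -> I).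

(** No element is above all of [D] in every order: each [y] is at most the whole
of [D] for some index. *)
Definition dominant (D : {set W}) :=
  [forall y, exists i, [forall x in D, r i y <= r i x]].

Lemma dominantP (D : {set W}) :
  reflect (forall y, exists i, forall x, x \in D -> r i y <= r i x)
          (dominant D).
Proof.
apply: (iffP forallP) => dD y.
  by have /existsP[i /forallP hi] := dD y; exists i => x; apply/implyP.
have [i hi] := dD y; apply/existsP; exists i.
by apply/forallP => x; apply/implyP/hi.
Qed.

Lemma dominantS (D E : {set W}) : E \subset D -> dominant D -> dominant E.
Proof.
move=> /fintype.subsetP sED /dominantP dD; apply/dominantP => y.
by have [i hi] := dD y; exists i => x /sED; apply: hi.
Qed.

(** A room is a dominant set with [#|I|] elements, and a door is a room with one
element removed; the completions of a door are the elements that make it a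
room. *)
Definition completions (E : {set W}) :=
  [set w | (w \notin E) && dominant (w |: E)].

(** The slack elements play the part of the facets of a simplex: [slack i] is the
bottom of the order [i] and, in all the other orders, lies above every proper
element, that is, every element outside the range of [slack]. *)
Hypothesis r_inj : forall i, injective (r i).
Hypothesis slack_min : forall i w, r i (slack i) <= r i w.
Hypothesis slack_max : forall i j w, i != j -> w \notin codom slack ->
  r i w < r i (slack j).
Hypothesis c_slack : forall i, c (slack i) = i.

Lemma le_slack i w : r i w <= r i (slack i) -> w = slack i.
Proof. by move=> h; apply: (@r_inj i); apply/eqP; rewrite eqn_leq h slack_min. Qed.

Section InnerDoor.
Variables (E : {set W}) (e0 : W) (m : I -> W).
Hypothesis domE : dominant E.
Hypothesis mE : forall i, m i \in E.
Hypothesis m_min : forall i e, e \in E -> r i (m i) <= r i e.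
Hypothesis e0E : e0 \in E.
Hypothesis e0W : e0 \notin codom slack.

(** An element of [E] must itself be below [E] for some order. *)
Lemma min_onto e : e \in E -> exists i, m i = e.
Proof.
move=> eE; have [i hi] := dominantP _ domE e; exists i.
by apply: (@r_inj i); apply/eqP; rewrite eqn_leq m_min // hi.
Qed.

(* [a] and [b] are the two indices that share their minimum over [E]. *)
Variables (a b : I).
Hypothesis ab : a != b.
Hypothesis m_inj : forall i j, i != a -> j != a -> m i = m j -> i = j.
Hypothesis mab : m a = m b.

(** The elements that could become the new minimum for the order [a] while every
other order keeps its minimum in [E]. *)
Definition above := [set w | [forall (i | i != a), r i (m i) < r i w]].

Lemma aboveP w :
  reflect (forall i, i != a -> r i (m i) < r i w) (w \in above).
Proof. by rewrite inE; apply: (iffP forallP) => h i; apply/implyP/h. Qed.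

(** Since [E] has a proper element, no minimum over [E] is a slack element of
another index, so that [slack a] clears all of them. *)
Lemma slack_above : slack a \in above.
Proof.
apply/aboveP => i ia; have [/codomP[j mj]|mi] := boolP (m i \in codom slack);
  last exact: slack_max.
have := m_min i e0E; have [ij _|ji] := eqVneq i j; last first.
  by rewrite mj leqNgt slack_max.
rewrite mj -ij ltn_neqAle slack_min andbT; apply: contra ia => /eqP /r_inj h.
by rewrite -(c_slack i) h c_slack.
Qed.

Lemma above_notin w : w \in above -> w \notin E.
Proof.
move=> /aboveP hw; apply/negP => /min_onto[i mi].
have [ia|ia] := eqVneq i a; last by have := hw _ ia; rewrite mi ltnn.
by have := hw b; rewrite eq_sym => /(_ ab); rewrite -mab -ia mi ltnn.
Qed.

Lemma max_above_completion w : w \in above ->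
  (forall y, y \in above -> r a y <= r a w) -> w \in completions E.
Proof.
move=> wA wmax; rewrite inE above_notin //=; apply/dominantP => y.
have [yA|/aboveP yA] := boolP (y \in above).
  have [i hi] := dominantP _ domE y; exists i => x.
  have ia : i = a.
    apply/eqP; apply: contraT => /(aboveP _ yA).
    by rewrite ltnNge hi.
  by rewrite ia => /setU1P[->|xE]; [exact: wmax | rewrite -ia; exact: hi].
have [i /andP[ia hi]] : exists i, (i != a) && (r i y <= r i (m i)).
  apply/existsP; apply: contra_notT yA => /existsPn h i ia.
  by have := h i; rewrite ia /= ltnNge.
exists i => x /setU1P[->|xE]; last exact: leq_trans hi (m_min _ xE).
by apply: leq_trans hi _; apply: ltnW; apply: (aboveP _ wA).
Qed.

Lemma completion_max_above w : w \in completions E ->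
  (forall x, x \in w |: E -> r a w <= r a x) ->
  w \in above /\ forall y, y \in above -> r a y <= r a w.
Proof.
rewrite inE => /andP[wE /dominantP dw] wmin.
have wA : w \in above.
  apply/aboveP => i ia; have [k hk] := dw (m i).
  have mk : m k = m i.
    apply: (@r_inj k); apply/eqP; rewrite eqn_leq m_min // hk //.
    by rewrite in_setU1 mE orbT.
  have ka : k != a.
    apply: contra wE => /eqP ka; suff -> : w = m i by [].
    apply: (@r_inj a); apply/eqP; rewrite eqn_leq wmin ?in_setU1 ?mE ?orbT //=.
    by rewrite -ka hk // in_setU1 eqxx.
  rewrite -(m_inj ka ia mk) mk ltn_neqAle hk ?in_setU1 ?eqxx // andbT.
  by apply: contra wE => /eqP/r_inj <-.
split=> // y /aboveP yA; have [i hi] := dw y.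
have [ia|ia] := eqVneq i a; first by rewrite -ia hi // in_setU1 eqxx.
by have := yA _ ia; rewrite ltnNge hi // in_setU1 mE orbT.
Qed.

(** Every index other than [a] and [b] is the only one to have its minimum, and
each element of [E] must keep an order of which it is the minimum; so the new
element takes over the order [a] or the order [b]. *)
Lemma completion_side w : w \in completions E ->
  exists2 k, (k == a) || (k == b) & forall x, x \in w |: E -> r k w <= r k x.
Proof.
rewrite inE => /andP[wE /dominantP dw]; have [k hk] := dw w; exists k => //.
apply: contraT; rewrite negb_or => /andP[ka kb].
have [i hi] := dw (m k).
have mik : m i = m k.
  apply: (@r_inj i); apply/eqP; rewrite eqn_leq m_min // hi //.
  by rewrite in_setU1 mE orbT.
have ik : i = k.
  have [ia|ia] := eqVneq i a; last exact: m_inj.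
  case/eqP: kb; apply: m_inj => //; first by rewrite eq_sym.
  by rewrite -mab -ia.
case/negP: wE; suff -> : w = m k by [].
apply: (@r_inj k); apply/eqP; rewrite eqn_leq hk ?in_setU1 ?mE ?orbT //=.
by move: hi; rewrite ik => -> //; rewrite in_setU1 eqxx.
Qed.

End InnerDoor.

(** The minima over [E] for the [#|E| + 1] orders cover [E], so exactly two orders
[a] and [b] share their minimum.  A completion takes over one of the two, and is
then the greatest element of [above] for that order; both candidates exist and
they differ. *)
Lemma card_inner_completions (E : {set W}) e0 :
  dominant E -> #|E|.+1 = #|I| -> e0 \in E -> e0 \notin codom slack ->
  #|completions E| = 2.
Proof.
move=> domE cardE e0E e0W.
pose m i := [arg min_(e < e0 in E) r i e].
have mE i : m i \in E by rewrite /m; case: arg_minnP.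
have m_min i e : e \in E -> r i (m i) <= r i e.
  by rewrite /m; case: arg_minnP => // x _; apply.
have onto := min_onto domE mE m_min.
have [a [b [ab mab]]] : exists a b, a != b /\ m a = m b.
  have /injectivePn[a [b h1 h2]] : ~~ injectiveb m; last by exists a, b.
  apply/negP => /injectiveP mi.
  have : #|m @: [set: I]| <= #|E|.
    by apply: subset_leq_card; apply/fintype.subsetP => _ /imsetP[i _ ->].
  by rewrite card_imset // cardsT -cardE ltnn.
have m_injD k l : k != l -> m k = m l ->
    forall i j, i != k -> j != k -> m i = m j -> i = j.
  move=> kl mkl i j ik jk; have /finset.imset_injP : #|m @: [set~ k]| == #|[set~ k]|.
    rewrite cardsC1 -cardE; apply/eqP/eq_card => e; apply/imsetP/idP => [[x _ ->] //|/onto[x xe]].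
    have [xk|xk] := eqVneq x k; last by exists x; rewrite ?inE.
    by exists l; rewrite ?inE 1?eq_sym // -xe xk.
  by apply; rewrite !inE.
have m_inja := m_injD _ _ ab mab.
have ba : b != a by rewrite eq_sym.
have m_injb := m_injD _ _ ba (esym mab).
have sa := slack_above m_min e0E e0W a.
have sb := slack_above m_min e0E e0W b.
pose wa := [arg max_(w > slack a in above m a) r a w].
pose wb := [arg max_(w > slack b in above m b) r b w].
have [waA wa_max] : wa \in above m a /\
    forall y, y \in above m a -> r a y <= r a wa.
  by rewrite /wa; case: arg_maxnP.
have [wbA wb_max] : wb \in above m b /\
    forall y, y \in above m b -> r b y <= r b wb.
  by rewrite /wb; case: arg_maxnP.
have wab : wa != wb.
  apply/eqP => wab; have [i hi] := dominantP _ domE wa.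
  have := hi _ (mE i); rewrite leqNgt => /negP; apply.
  have [->|ia] := eqVneq i a; last exact: (aboveP _ _ _ waA).
  by rewrite wab; apply: (aboveP _ _ _ wbA).
rewrite -[2]/(true.+1) -wab -cards2; apply: eq_card => w; apply/idP/set2P => [wC|[]->]; last 2 first.
- exact: (max_above_completion domE mE m_min ab mab).
- exact: (max_above_completion domE mE m_min ba (esym mab)).
have [k /orP[]/eqP-> kw] := completion_side mE m_min ab m_inja mab wC.
- have [h1 h2] := completion_max_above mE m_min m_inja wC kw.
  by left; apply: (@r_inj a); apply/eqP; rewrite eqn_leq h2 // wa_max.
- have [h1 h2] := completion_max_above mE m_min m_injb wC kw.
  by right; apply: (@r_inj b); apply/eqP; rewrite eqn_leq h2 // wb_max.
Qed.

Variables (w0 : W) (i0 : I).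
Hypothesis w0W : w0 \notin codom slack.

Definition outside := slack @: [set~ i0].

Lemma notin_outside w : (w \notin outside) = (w == slack i0) || (w \notin codom slack).
Proof.
apply/idP/orP => [h|[/eqP->|h]]; last first.
- by apply: contra h => /imsetP[i _ ->]; exact: codom_f.
- apply/negP => /imsetP[j]; rewrite !inE => /eqP ji0 /(congr1 c).
  by rewrite !c_slack => /esym.
apply/orP; apply: contraT; rewrite negb_or negbK => /andP[w1 /codomP[i wi]].
case/negP: h; apply/imsetP; exists i => //; rewrite !inE.
by apply: contra w1 => /eqP <-; rewrite wi.
Qed.

(** The only proper completion of the door made of all slack elements but one is
the greatest proper element for the missing order; adding the missing slack
element leaves the proper elements undominated. *)
Lemma card_outside_completions : #|completions outside| = 1.
Proof.
pose w1 := [arg max_(w > w0 | w \notin codom slack) r i0 w].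
have [w1W w1_max] : w1 \notin codom slack /\
    forall y, y \notin codom slack -> r i0 y <= r i0 w1.
  by rewrite /w1; case: arg_maxnP.
suff -> : completions outside = [set w1] by rewrite cards1.
have side w y i : w \in completions outside -> y \notin codom slack ->
    (forall x, x \in w |: outside -> r i y <= r i x) -> i = i0.
  move=> _ yW hi; apply/eqP; apply: contraT => ii0; case/negP: yW.
  rewrite (@le_slack i y) ?codom_f // hi // in_setU1; apply/orP; right.
  by apply/imsetP; exists i; rewrite ?inE.
apply/setP => w; apply/idP/set1P => [wC|->].
  have := wC; rewrite inE notin_outside => /andP[/orP[/eqP wi0|wW] /dominantP dw].
    have [i hi] := dw w0; have ii0 := side _ _ _ wC w0W hi.
    case/negP: w0W; rewrite (@le_slack i w0) ?codom_f // hi // ii0 wi0.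
    exact: setU11.
  have [i hi] := dw w1; have ii0 := side _ _ _ wC w1W hi.
  apply: (@r_inj i0); apply/eqP; rewrite eqn_leq w1_max // -ii0 hi //.
  exact: setU11.
rewrite inE notin_outside w1W orbT /=; apply/dominantP => y.
have [/codomP[j ->]|yW] := boolP (y \in codom slack).
  by exists j => x _; exact: slack_min.
exists i0 => x /setU1P[->|/imsetP[j]]; first exact: w1_max.
by rewrite !inE => ji0 ->; apply/ltnW/slack_max; rewrite // eq_sym.
Qed.

Lemma slack_door (E : {set W}) :
  c @: E = [set~ i0] -> {subset E <= codom slack} -> E = outside.
Proof.
move=> cE sE; apply/setP => w; apply/idP/imsetP => [wE|[i + ->]].
  have /codomP[i wi] := sE _ wE; exists i => //.
  by rewrite -cE -(c_slack i) -wi imset_f.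
rewrite -cE => /imsetP[x xE ->].
by have /codomP[j xj] := sE _ xE; rewrite {1}xj c_slack -xj.
Qed.

(** If removing [w] leaves all colours but [i0], each once, then [w], which cannot
have the colour [i0], repeats the colour of a single other element, and that
element is the only other one that may be removed. *)
Lemma even_card_room_doors (D : {set W}) : #|D| = #|I| -> c @: D != [set: I] ->
  ~~ odd #|[set w in D | c @: (D :\ w) == [set~ i0]]|.
Proof.
move=> cardD cD; set P := [set w in D | _].
have [->|[w]] := set_0Vmem P; first by rewrite cards0.
rewrite inE => /andP[wD /eqP cw].
have injD x y : x \in D -> x != w -> y \in D -> y != w -> c x = c y -> x = y.
  move=> xD xw yD yw; have /finset.imset_injP : #|c @: (D :\ w)| == #|D :\ w|.
    by rewrite cw cardsC1 -cardD (cardsD1 w D) wD.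
  by apply; rewrite !inE ?xw ?yw.
have : c w \in [set~ i0].
  rewrite !inE; apply: contra cD => /eqP cwi; apply/eqP/setP => i; rewrite inE.
  have [->|ii0] := eqVneq i i0; first by rewrite -cwi imset_f.
  have : i \in c @: (D :\ w) by rewrite cw !inE.
  by move=> /imsetP[x /setD1P[_ xD] ->]; exact: imset_f.
rewrite -cw => /imsetP[v /setD1P[vw vD] cwv].
suff -> : P = [set w; v] by rewrite cards2 eq_sym vw.
apply/setP => x; apply/idP/set2P => [|[]->].
- rewrite inE => /andP[xD /eqP cx].
  have [->|xw] := eqVneq x w; [by left | right].
  have : c x \in c @: (D :\ x).
    by rewrite cx -cw; apply: imset_f; rewrite !inE xw.
  move=> /imsetP[u /setD1P[ux uD] cxu].
  have [uw|uw] := eqVneq u w; last first.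
    by case/eqP: ux; apply: injD.
  by apply: injD => //; rewrite cxu uw.
- by rewrite inE wD cw eqxx.
- rewrite inE vD /= -cw; apply/eqP/setP => i; apply/imsetP/imsetP.
    move=> [u /setD1P[uv uD] ->]; have [->|uw] := eqVneq u w.
      by exists v; rewrite // !inE vw.
    by exists u; rewrite // !inE uw.
  move=> [u /setD1P[uw uD] ->]; have [->|uv] := eqVneq u v.
    by exists w; rewrite // !inE eq_sym vw.
  by exists u; rewrite // !inE uv.
Qed.

(** Count modulo 2 the pairs of a room and a door in it whose colours are all but
[i0].  Every such set lies in an even number of rooms, two or none, except
[outside], which lies in one; so some room has an odd number of these doors, and by
[even_card_room_doors] it bears all the colours. *)
Theorem scarf : exists2 D : {set W}, dominant D & c @: D = [set: I].
Proof.
apply: contrapT => hno.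
have cI : 0 < #|I| by rewrite -cardsT; apply/card_gt0P; exists i0.
pose room (D : {set W}) := dominant D && (#|D| == #|I|).
pose door (E : {set W}) := c @: E == [set~ i0].
pose N := \sum_(D | room D) \sum_(w | (w \in D) && door (D :\ w)) 1.
have evenN : ~~ odd N.
  rewrite /N; elim/big_ind: _ => // [x y|D /andP[dD /eqP cD]].
    by rewrite oddD => /negbTE-> /negbTE->.
  rewrite sum1dep_card; apply: even_card_room_doors => //.
  by apply/eqP => h; apply: hno; exists D.
have := evenN; rewrite /N (exchange_big_dep xpredT) //=.
pose cnt E := #|[set w in completions E | #|E|.+1 == #|I|]|.
suff -> : \sum_w \sum_(D | room D && ((w \in D) && door (D :\ w))) 1 =
    \sum_(E | door E) cnt E.
  rewrite (bigD1 outside) /=; last first.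
    apply/eqP/setP => i; rewrite -imset_comp; apply/imsetP/idP => [[j jI ->]|iI].
      by rewrite /= c_slack.
    by exists i; rewrite //= c_slack.
  have cardO : #|outside|.+1 == #|I|.
    rewrite card_imset ?cardsC1 ?prednK //.
    by move=> i j /(congr1 c); rewrite !c_slack.
  have -> : cnt outside = 1.
    by rewrite /cnt -card_outside_completions; apply: eq_card => w; rewrite !inE cardO andbT.
  rewrite addSn add0n /= negbK => /negP[]; apply/negP.
  elim/big_ind: _ => // [x y|E /andP[/eqP cE EO]].
    by rewrite oddD => /negbTE-> /negbTE->.
  rewrite /cnt; have [/eqP cardE|_] := boolP (#|E|.+1 == #|I|); last first.
    by rewrite (_ : [set w in _ | _] = finset.set0) ?cards0 //; apply/setP => w; rewrite !inE andbF.
  rewrite (_ : [set w in _ | _] = completions E); last first.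
    by apply/setP => w; rewrite !inE andbT.
  have [->|[w wC]] := set_0Vmem (completions E); first by rewrite cards0.
  have domE : dominant E.
    move: wC; rewrite inE => /andP[_]; apply: dominantS; exact: finset.subsetUr.
  have [e eE eW] : exists2 e, e \in E & e \notin codom slack.
    apply/exists_inP; apply: contraT => /exists_inPn h.
    by case/eqP: EO; apply: slack_door => // x /h; rewrite negbK.
  by rewrite (card_inner_completions domE cardE eE eW).
transitivity (\sum_w \sum_(E | door E && ((w \in completions E) && (#|E|.+1 == #|I|))) 1).
  apply: eq_bigr => w _.
  rewrite (reindex_onto (fun E => w |: E) (fun D => D :\ w)) /=; last first.
    by move=> D /and3P[_ wD _]; rewrite finset.setD1K.
  apply: eq_bigl => E; rewrite setU11 /= /room inE cardsU1.
  have [wE|wE] /= := boolP (w \in E).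
    rewrite andbF; apply/negbTE; apply/negP => /andP[_ /eqP h].
    by have := setD11 w (w |: E); rewrite h wE.
  by rewrite add1n finset.setU1K // eqxx andbT andbC.
rewrite (exchange_big_dep door) /=; last by move=> w E _ /andP[].
apply: eq_bigr => E dE; rewrite sum1dep_card /cnt; apply: eq_card => w.
by rewrite !inE dE.
Qed.

End Scarf.

(** * Colourings of a grid in the simplex *)
Section Grid.
Local Open Scope nat_scope.
Variables (N L : nat).

(** The points of the standard simplex whose barycentric coordinates are multiples
of [1 / L], scaled by [L]. *)
Definition grid := {f : {ffun 'I_N -> 'I_L.+1} | \sum_i f i == L}.
Implicit Types x y : grid.

Definition coord x i : nat := val x i.

Lemma sum_coord x : \sum_i coord x i = L.
Proof. exact/eqP/(valP x). Qed.

Lemma grid_exists (u : 'I_N -> nat) : \sum_i u i = L ->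
  exists y, forall i, coord y i = u i.
Proof.
move=> su; have uL i : u i < L.+1 by rewrite ltnS -su (bigD1 i) //= leq_addr.
have sf : \sum_i [ffun i => Ordinal (uL i)] i == L.
  by apply/eqP; rewrite -[RHS]su; apply: eq_bigr => i _; rewrite ffunE.
pose y : grid := exist (fun f : {ffun 'I_N -> 'I_L.+1} => \sum_i f i == L) _ sf.
by exists y => i; rewrite /coord /= ffunE.
Qed.

Variables (i0 : 'I_N) (c : grid -> 'I_N).

(* Points are ordered by their [i]-th coordinate, ties being broken by an
   enumeration; the successor leaves room for the bottom element [inr i]. *)
Let rank (i : 'I_N) (v : grid + 'I_N) : nat :=
  match v with
  | inl x => (coord x i * #|{: grid}| + enum_rank x).+1
  | inr j => if i == j then 0 else (L.+1 * #|{: grid}| + j).+1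
  end.

Lemma ltn_rank_grid i x : coord x i * #|{: grid}| + enum_rank x < L.+1 * #|{: grid}|.
Proof.
have h : coord x i < L.+1 by rewrite /coord; apply: ltn_ord.
by rewrite (leq_trans _ (leq_mul h (leqnn _))) // mulSn addnC ltn_add2r ltn_ord.
Qed.

Lemma rank_inj i : injective (rank i).
Proof.
have aux x j : rank i (inl x) <> rank i (inr j).
  rewrite /=; case: ifP => // _ [] h; have := ltn_rank_grid i x.
  by rewrite h ltnNge leq_addr.
move=> [x|j] [y|k] /=.
- case=> h; congr inl; apply: enum_rank_inj; apply: val_inj => /=.
  have := congr1 (modn^~ #|{: grid}|) h.
  by rewrite !modnMDl !modn_small.
- by move=> h; case: (aux x k).
- by move=> h; case: (aux y j).
- have [<-|ij] := eqVneq i j; have [<-|ik] := eqVneq i k => //.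
  by case=> /addnI/val_inj ->.
Qed.

(** Let [C] be the set of indices whose slack element is not in the dominant set.
Were the minima [m i] of the coordinates in [C] to satisfy
[sum (m i + 1) <= L], some grid point would exceed the dominant set in all the
orders of [C].  So these minima almost exhaust the total [L]: coordinates in [C]
vary by at most [N] over the dominant set and the other ones are at most [N]. *)
Lemma near_colours : exists x, forall i,
  coord x i <= N \/
  exists y, c y = i /\ forall j, coord x j <= coord y j + N /\ coord y j <= coord x j + N.
Proof.
have [w0 _] : exists w0 : grid, forall i, coord w0 i = if i == i0 then L else 0.
  by apply: grid_exists; rewrite -big_mkcond big_pred1_eq.
pose c' (v : grid + 'I_N) := match v with inl x => c x | inr j => j end.
have notslack x : (inl x : grid + 'I_N) \notin codom inr.
  by apply/negP => /codomP[].
have [| | | |D domD cD] := @scarf _ _ rank inr c' rank_inj _ _ _ (inl w0) i0 _.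
- by move=> i w; rewrite /= eqxx.
- move=> i j [x|k] ij; last by rewrite codom_f.
  by move=> _; rewrite /= (negbTE ij) ltnS (leq_trans (ltn_rank_grid _ _)) ?leq_addr.
- by [].
- exact: notslack.
pose C := [set i | inr i \notin D].
have colC i : i \in C -> exists x, inl x \in D /\ c x = i.
  rewrite inE => iD; have : i \in c' @: D by rewrite cD inE.
  move=> /imsetP[[x xD ->|j jD ij]]; first by exists x.
  by rewrite ij /= jD in iD.
have domC y : exists2 i, i \in C & forall x, inl x \in D -> coord y i <= coord x i.
  have [i hi] := dominantP _ _ domD (inl y); exists i.
    by rewrite inE; apply/negP => /hi; rewrite /= eqxx.
  move=> x /hi; rewrite /= ltnS => h.
  rewrite -ltnS -(ltn_pmul2r (_ : 0 < #|{: grid}|)); last first.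
    by apply/card_gt0P; exists w0.
  by rewrite (leq_ltn_trans (leq_addr (enum_rank y) _)) // (leq_ltn_trans h) // mulSn addnC ltn_add2r ltn_ord.
have [i1 i1C _] := domC w0.
have [x1 [x1D _]] := colC _ i1C.
pose m i := coord [arg min_(x < x1 | inl x \in D) coord x i] i.
have m_le i x : inl x \in D -> m i <= coord x i.
  by rewrite /m; case: arg_minnP => // z _; apply.
have m_eq i : exists2 x, inl x \in D & m i = coord x i.
  by rewrite /m; case: arg_minnP => // z zD _; exists z.
have sumC x : \sum_(i in C) coord x i + \sum_(i | i \notin C) coord x i = L.
  by rewrite -(sum_coord x) [RHS](bigID (mem C)).
have sum_m : L < \sum_(i in C) (m i).+1.
  rewrite ltnNge; apply/negP; rewrite (bigD1 i1) //=.
  set s := \sum_(i in C | _) _ => hs.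
  have [y hy] : exists y, forall i, coord y i =
     if i == i1 then L - s else if i \in C then (m i).+1 else 0.
    apply: grid_exists; rewrite (bigD1 i1) //= eqxx.
    rewrite (_ : \sum_(i | _) _ = s) ?subnK //; last first.
      rewrite /s big_mkcondl /=; apply: eq_bigr => i /negbTE ->.
      by case: ifP.
    by apply: leq_trans hs; rewrite leq_addl.
  have [i iC hi] := domC y; have [x xD mx] := m_eq i.
  have := hi _ xD; rewrite hy -mx iC; case: eqVneq => [->|_]; last by rewrite ltnn.
  by move: hs; clearbody s; lia.
have cardC : #|C| <= N by rewrite -[X in _ <= X](card_ord N) max_card.
have {}sum_m : L < \sum_(i in C) m i + N.
  apply: leq_trans sum_m _; rewrite (eq_bigr (fun i => m i + 1)); last first.
    by move=> i _; rewrite addn1.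
  by rewrite big_split /= sum1_card leq_add2l.
clearbody m.
have inC x i : inl x \in D -> i \in C -> coord x i <= m i + N.
  move=> xD iC; have := sumC x; have := sum_m.
  rewrite (bigD1 i) //= [X in X + _ = _](bigD1 i) //=.
  have : \sum_(j in C | j != i) m j <= \sum_(j in C | j != i) coord x j.
    by apply: leq_sum => j _; exact: m_le.
  move: (\sum_(j in C | _) _) (\sum_(j in C | _) _) (\sum_(j | j \notin C) _).
  by move=> u v z *; lia.
have outC x i : inl x \in D -> i \notin C -> coord x i <= N.
  move=> xD iC; have := sumC x; have := sum_m.
  rewrite [X in _ + X = _](bigD1 i) //=.
  have : \sum_(j in C) m j <= \sum_(j in C) coord x j.
    by apply: leq_sum => j _; exact: m_le.
  move: (\sum_(j in C) m j) (\sum_(j in C) _) (\sum_(j | _) _).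
  by move=> u v z *; lia.
exists x1 => i; have [iC|iC] := boolP (i \in C); last by left; exact: outC.
right; have [y [yD cy]] := colC _ iC; exists y; split=> // j.
have [jC|jC] := boolP (j \in C).
  split; first by apply: leq_trans (inC _ _ x1D jC) _; rewrite leq_add2r m_le.
  by apply: leq_trans (inC _ _ yD jC) _; rewrite leq_add2r m_le.
by split; rewrite (leq_trans (outC _ _ _ jC)) // leq_addl.
Qed.

End Grid.

(** * Zeros and variational inequalities on the simplex *)
Section Simplex.
Import numFieldNormedType.Exports.
Local Open Scope ring_scope.
Local Open Scope classical_set_scope.
Variables (R : realType) (N : nat).
Implicit Types s t : 'rV[R]_N.

Definition simplex : set 'rV[R]_N :=
  [set t | (forall i, 0 <= t 0 i) /\ \sum_i t 0 i = 1].

Definition dist1 s t : R := \sum_j `|s 0 j - t 0 j|.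

Lemma dist1_ge0 s t : 0 <= dist1 s t.
Proof. by apply: sumr_ge0 => j _. Qed.

Lemma le_dist1 s t j : `|s 0 j - t 0 j| <= dist1 s t.
Proof. by rewrite /dist1 (bigD1 j) //= lerDl sumr_ge0. Qed.

Lemma simplex_le1 t i : simplex t -> t 0 i <= 1.
Proof.
by move=> [t0 <-]; rewrite (bigD1 i) //= lerDl sumr_ge0.
Qed.

Lemma simplex_vertex (i : 'I_N) : simplex (delta_mx 0 i).
Proof.
split=> [j|]; first by rewrite mxE eqxx ler0n.
rewrite (bigD1 i) //= big1 => [|j /negbTE ji]; rewrite mxE ?ji //.
by rewrite !eqxx addr0.
Qed.

Lemma compact_simplex : compact simplex.
Proof.
have box : compact [set v : 'rV[R]_N | forall i, `[0%R, 1%R]%classic (v ord0 i)].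
  apply: (@rV_compact R N (fun=> `[0%R, 1%R]%classic)) => _.
  exact: segment_compact.
apply: subclosed_compact box _; last first.
  move=> t ts i; rewrite /= in_itv /=; apply/andP; split; first exact: ts.1.
  exact: simplex_le1.
have -> : simplex = [set t | \sum_i t 0 i = 1] `&`
    \bigcap_(i in setT) [set t | 0 <= t 0 i].
  apply/seteqP; split=> t [h1 h2]; first exact: (conj h2 (fun i _ => h1 i)).
  exact: (conj (fun i => h2 i I) h1).
apply: closedI.
  apply: (@closed_comp _ _ (fun t : 'rV[R]_N => \sum_i t 0 i) [set x | x = 1]).
    move=> t _; apply: (continuous_big (@add_continuous R^o)) => i _.
    exact: coord_continuous.
  exact: closed_eq.
apply: closed_bigI => i _.
apply: (@closed_comp _ _ (fun t : 'rV[R]_N => t 0 i) [set x | 0 <= x]).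
  by move=> t _; exact: coord_continuous.
exact: closed_ge.
Qed.

Lemma lipschitz_min (f : 'rV[R]_N -> R) (K : R) : (0 < N)%N -> 0 <= K ->
  (forall s t, simplex s -> simplex t -> `|f s - f t| <= K * dist1 s t) ->
  exists2 t, simplex t & forall s, simplex s -> f t <= f s.
Proof.
move=> N0 K0 lipf.
have ne : simplex !=set0.
  by exists (delta_mx 0 (Ordinal N0)); exact: simplex_vertex.
have [|t tS tmin] := compact_EVT_min ne compact_simplex (f := f); last first.
  by exists t => [|s sS]; [exact: set_mem | apply: tmin; exact: mem_set].
apply/subspace_continuousP => x xS; apply/cvgrPdist_le => e e0.
have d0 : 0 < e / (K * N%:R + 1).
  by rewrite divr_gt0 // ltr_wpDl // mulr_ge0.
rewrite near_withinE.
have : \forall t \near x, forall j : 'I_N, `|x 0 j - (t : 'rV[R]_N) 0 j| < e / (K * N%:R + 1).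
  apply: (@filter_forall _ _ (fun j (t : 'rV[R]_N) => `|x 0 j - t 0 j| < _)
    (nbhs x) (nbhs_filter x)) => j.
  have := @coord_continuous R 1 N 0 j x.
  by move=> /cvgrPdist_lt/(_ _ d0).
apply: filterS => t ht tS; apply: le_trans (lipf _ _ xS tS) _.
apply: (@le_trans _ _ (K * (N%:R * (e / (K * N%:R + 1))))).
  apply: ler_wpM2l => //.
  apply: (@le_trans _ _ (\sum_(j < N) (e / (K * N%:R + 1)))).
    by apply: ler_sum => j _; exact: ltW.
  by rewrite sumr_const card_ord -[leLHS]mulr_natl.
have p0 : 0 < K * N%:R + 1 by rewrite ltr_wpDl // mulr_ge0.
by rewrite !mulrA ler_pdivrMr // [leLHS]mulrC ler_pM2l // lerDl.
Qed.

Section Zero.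
Variables (g : 'I_N -> 'rV[R]_N -> R) (K : R).
Hypothesis N0 : (0 < N)%N.
Hypothesis K0 : 0 <= K.
Hypothesis lipg : forall i s t, simplex s -> simplex t ->
  `|g i s - g i t| <= K * dist1 s t.
Hypothesis sumg : forall t, simplex t -> \sum_i g i t = 0.
Hypothesis lbg : forall i t, simplex t -> - (K * t 0 i) <= g i t.

(** Colour a grid point by an index where [g] is nonnegative.  At a point given by
[near_colours] each component of [g] is then almost nonnegative, either by the
Lipschitz bound or because the coordinate is small; as the components add up to
0, all of them are small. *)
Lemma simplex_approx_zero (e : R) : 0 < e ->
  exists2 t, simplex t & \sum_i `|g i t| <= e.
Proof.
move=> e0; pose i0 := Ordinal N0.
(* The components will be at least [- d] with [d = K N^2 / L], which bounds the
   sum of their absolute values by [2 N d = M / L]. *)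
pose M := (K * N%:R * N%:R) *+ 2 * N%:R.
have M0 : 0 <= M by rewrite !(mulr_ge0, mulrn_wge0).
pose L := (Num.bound (M / e)).+1.
have L0 : 0 < L%:R :> R by rewrite ltr0n.
pose pt (x : grid N L) : 'rV[R]_N := \row_i ((coord x i)%:R / L%:R).
have ptS x : simplex (pt x).
  split=> [i|]; first by rewrite mxE divr_ge0.
  under eq_bigr do rewrite mxE.
  by rewrite -mulr_suml -natr_sum sum_coord divff // gt_eqF.
pose c x := odflt i0 [pick i | 0 <= g i (pt x)].
have gc x : 0 <= g (c x) (pt x).
  rewrite /c; case: pickP => [i //|/= h]; exfalso.
  have : \sum_i g i (pt x) < 0.
    rewrite [ltRHS](_ : 0 = \sum_(i < N) 0); last by rewrite big1.
    apply: ltr_sum => [|i _]; first by apply/hasP; exists i0; rewrite ?mem_index_enum.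
    by rewrite ltNge h.
  by rewrite sumg // ltxx.
have [x hx] := near_colours i0 c; exists (pt x) => //.
pose d := K * N%:R * N%:R / L%:R.
have gd i : - d <= g i (pt x).
  have N1 : 1 <= N%:R :> R by rewrite ler1n.
  case: (hx i) => [xN|[y [cy yN]]].
    apply: le_trans (lbg i (ptS x)); rewrite lerN2 mxE /d mulrA ler_wpM2r //.
      by rewrite invr_ge0 ltW.
    rewrite -mulrA ler_wpM2l // (le_trans (_ : _ <= N%:R)) ?ler_nat //.
    by rewrite ler_peMr.
  have := lipg i (ptS y) (ptS x); rewrite -{1}cy => /(le_trans (ler_norm _)).
  rewrite lerBlDr => h; have {h} := le_trans (gc y) h => h.
  rewrite lerNl -subr_ge0 opprK; apply: le_trans h _; rewrite lerD2r.
  rewrite /d -!mulrA ler_wpM2l //.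
  apply: (@le_trans _ _ (\sum_(j < N) N%:R / L%:R)); last first.
    by rewrite sumr_const card_ord -[leLHS]mulr_natl.
  apply: ler_sum => j _; rewrite !mxE -mulrBl normrM [X in _ * X]ger0_norm ?invr_ge0 ?(ltW L0) //.
  rewrite ler_wpM2r ?invr_ge0 ?(ltW L0) // ler_norml.
  have [h1 h2] := yN j.
  rewrite lerBrDr lerBlDr addrC lerBlDr -!natrD !ler_nat h1 /=.
  by rewrite addnC h2.
have {}gd i : `|g i (pt x)| <= g i (pt x) + d *+ 2.
  rewrite ler_norml lerDl.
  have d0 : 0 <= d by rewrite /d divr_ge0 ?(ltW L0) // !mulr_ge0.
  rewrite mulrn_wge0 // andbT; have := gd i; lra.
apply: le_trans (ler_sum _ (fun i _ => gd i)) _.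
rewrite big_split /= sumg // add0r sumr_const card_ord.
have -> : d *+ 2 *+ N = M / L%:R by rewrite /d /M -[LHS]mulr_natr; ring.
rewrite ler_pdivrMr // mulrC -ler_pdivrMr //.
apply: ltW; apply: (lt_le_trans (archi_boundP _)); first by rewrite divr_ge0 // (ltW e0).
by rewrite ler_nat leqnSn.
Qed.

(** Minimize the sum of the absolute values of the components. *)
Lemma simplex_zero : exists2 t, simplex t & forall i, g i t = 0.
Proof.
have [|s t sS tS|t tS tmin] := @lipschitz_min (fun t => \sum_i `|g i t|) (N%:R * K) N0.
- by rewrite mulr_ge0.
- rewrite -sumrB (le_trans (ler_norm_sum _ _ _)) //.
  apply: (@le_trans _ _ (\sum_(j < N) (K * dist1 s t))).
    apply: ler_sum => i _; apply: le_trans (lipg i sS tS).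
    exact: ler_dist_dist.
  by rewrite sumr_const card_ord -[leLHS]mulr_natl mulrA.
exists t => // i; apply/eqP; rewrite -normr_eq0 eq_le normr_ge0 andbT.
apply/ler_addgt0Pl => e e0; rewrite addr0.
have [s sS sle] := simplex_approx_zero e0.
apply: le_trans sle; apply: le_trans (tmin _ sS).
by rewrite (bigD1 i) //= lerDl sumr_ge0.
Qed.

End Zero.

(** A zero [t] of [psi i - t i * S], where [psi i = max 0 (phi i)] and [S] is the
sum of the [psi i], will do: some [i] has [t i > 0] and [phi i <= 0] because the
[phi i] have average 0 for the weights [t i], and this forces [S = 0]. *)
Lemma simplex_variational (phi : 'I_N -> 'rV[R]_N -> R) (K : R) : (0 < N)%N ->
  (forall i s t, simplex s -> simplex t ->
     `|phi i s - phi i t| <= K * dist1 s t) ->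
  (forall i t, simplex t -> `|phi i t| <= K) ->
  (forall t, simplex t -> \sum_i t 0 i * phi i t = 0) ->
  exists2 t, simplex t & forall i, phi i t <= 0.
Proof.
move=> N0 lipphi bphi sphi.
pose psi i t := Num.max 0 (phi i t).
pose S t := \sum_i psi i t.
have psi_ge0 i t : 0 <= psi i t by rewrite le_max lexx.
have S_ge0 t : 0 <= S t by apply: sumr_ge0.
have K0 : 0 <= K.
  exact: le_trans (bphi (Ordinal N0) _ (simplex_vertex (Ordinal N0))).
have bpsi i t : simplex t -> psi i t <= K.
  by move=> tS; rewrite ge_max K0 (le_trans (ler_norm _) (bphi _ _ tS)).
have lippsi i s t : simplex s -> simplex t -> `|psi i s - psi i t| <= K * dist1 s t.
  move=> sS tS; apply: le_trans (lipphi i s t sS tS).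
  have := lexx `|phi i s - phi i t|; rewrite {1}ler_norml => /andP[].
  have := normr_ge0 (phi i s - phi i t); move: `|_| => d.
  rewrite /psi ler_norml /Num.max.
  by case: (ltP 0 (phi i s)) => ?; case: (ltP 0 (phi i t)) => ? ? ? ?; apply/andP; split; lra.
have bS t : simplex t -> S t <= N%:R * K.
  move=> tS; apply: le_trans (ler_sum _ (fun i _ => bpsi i t tS)) _.
  by rewrite sumr_const card_ord -[leLHS]mulr_natl.
have lipS s t : simplex s -> simplex t -> `|S s - S t| <= N%:R * K * dist1 s t.
  move=> sS tS; rewrite -sumrB (le_trans (ler_norm_sum _ _ _)) //.
  apply: le_trans (ler_sum _ (fun i _ => lippsi i s t sS tS)) _.
  by rewrite sumr_const card_ord -[leLHS]mulr_natl mulrA.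
have [| | |i t tS|t tS gt] := @simplex_zero (fun i t => psi i t - t 0 i * S t)
    (K + (N%:R * K) *+ 2) N0.
- by rewrite addr_ge0 // mulrn_wge0 // mulr_ge0.
- move=> i s t sS tS.
  rewrite (_ : _ - _ = psi i s - psi i t - ((s 0 i - t 0 i) * S s + t 0 i * (S s - S t))); last by ring.
  apply: le_trans (ler_normB _ _) _; rewrite [leRHS]mulrDl lerD ?lippsi //.
  apply: le_trans (ler_normD _ _) _; rewrite mulr2n [leRHS]mulrDl lerD // normrM.
    rewrite mulrC; apply: ler_pM => //; last exact: le_dist1.
    by rewrite ger0_norm ?bS.
  rewrite -[leRHS]mul1r ler_pM // ?lipS // ger0_norm ?simplex_le1 //.
  exact: tS.1.
- move=> t tS; rewrite sumrB -mulr_suml tS.2 mul1r.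
  exact: subrr.
- apply: (@le_trans _ _ (- (t 0 i * S t))); last by rewrite lerDr.
  rewrite lerN2 mulrC ler_wpM2r ?tS.1 //.
  apply: le_trans (bS _ tS) _; rewrite mulr2n.
  have := K0; have : 0 <= N%:R * K by rewrite mulr_ge0.
  lra.
exists t => // i.
have [j [tj phij]] : exists j, 0 < t 0 j /\ phi j t <= 0.
  apply: contrapT => h.
  have hj j : 0 < t 0 j -> 0 < phi j t.
    by move=> tj; rewrite ltNge; apply/negP => hj; apply: h; exists j.
  have hge j : 0 <= t 0 j * phi j t.
    have := tS.1 j; rewrite le_eqVlt => /predU1P[<-|tj]; first by rewrite mul0r.
    by rewrite mulr_ge0 // ltW // hj.
  have := sphi _ tS => /eqP; rewrite psumr_eq0 // => /allP h0.
  have t0 j : t 0 j = 0.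
    have := h0 j; rewrite mem_index_enum => /(_ isT) /=; rewrite mulf_eq0.
    case/orP => /eqP // h1; have := tS.1 j; rewrite le_eqVlt => /predU1P[<- //|tj].
    by have := hj _ tj; rewrite h1 ltxx.
  have := tS.2; rewrite big1 // => /eqP; rewrite eq_sym oner_eq0.
  by [].
have S0 : S t = 0.
  have := gt j; rewrite /psi max_l // sub0r => /eqP; rewrite oppr_eq0 mulf_eq0.
  by rewrite gt_eqF //= => /eqP.
have := gt i; rewrite S0 mulr0 subr0 /psi => h.
by rewrite -h le_max lexx orbT.
Qed.

End Simplex.

Local Open Scope ring_scope.
Local Open Scope complex_scope.
Local Open Scope sesquilinear_scope.
Local Open Scope classical_set_scope.


(** * Functional calculus of hermitian matrices *)
Section FunctionalCalculus.
Variables (R : realType) (n : nat).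
Implicit Types (A B S T U V : 'M[R[i]]_n) (d e : 'rV[R]_n) (f : R -> R).

Lemma hermP A : A \is hermsymmx <-> A ^t* = A.
Proof.
split=> [/is_hermitianmxP|hA]; first by rewrite expr0 scale1r => /esym.
by apply/is_hermitianmxP; rewrite expr0 scale1r hA.
Qed.

Lemma trmxC_mul m p q (X : 'M[R[i]]_(m, p)) (Y : 'M[R[i]]_(p, q)) :
  (X *m Y) ^t* = Y ^t* *m X ^t*.
Proof. by rewrite trmx_mul map_mxM. Qed.

Lemma conj_realC (x : R) : Num.conj (x%:C) = x%:C.
Proof. by rewrite conj_Creal // complex_real eqxx. Qed.

Definition realdiag d : 'M[R[i]]_n := diag_mx (map_mx (real_complex R) d).

Definition udiag U d := U ^t* *m realdiag d *m U.

Lemma realdiagM d e :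
  realdiag d *m realdiag e = realdiag (\row_i (d 0 i * e 0 i)).
Proof.
rewrite /realdiag mulmx_diag; congr diag_mx.
by apply/rowP => i; rewrite !mxE rmorphM.
Qed.

Lemma realdiag1 : realdiag (const_mx 1) = 1%:M.
Proof.
rewrite -diag_const_mx; congr diag_mx.
by apply/rowP => i; rewrite !mxE.
Qed.

Lemma realdiag_herm d : (realdiag d) ^t* = realdiag d.
Proof.
rewrite /realdiag tr_diag_mx map_diag_mx; congr diag_mx.
apply/rowP => i; rewrite !mxE; exact: conj_realC.
Qed.

Lemma unitaryKl U : U \is unitarymx -> U ^t* *m U = 1%:M.
Proof.
by move=> Uu; rewrite -invmx_unitary // mulVmx // unitarymx_unit.
Qed.

Lemma unitaryKr U : U \is unitarymx -> U *m U ^t* = 1%:M.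
Proof. by move/unitarymxP. Qed.

Lemma udiagM U d e : U \is unitarymx ->
  udiag U d *m udiag U e = udiag U (\row_i (d 0 i * e 0 i)).
Proof.
move=> Uu; rewrite /udiag -realdiagM.
transitivity (U ^t* *m realdiag d *m (U *m U ^t*) *m realdiag e *m U).
  by rewrite !mulmxA.
by rewrite (unitaryKr Uu) mulmx1 !mulmxA.
Qed.

Lemma udiag1 U : U \is unitarymx -> udiag U (const_mx 1) = 1%:M.
Proof. by move=> Uu; rewrite /udiag realdiag1 mulmx1 unitaryKl. Qed.

Lemma udiag_herm U d : (udiag U d) ^t* = udiag U d.
Proof. by rewrite /udiag !trmxC_mul trmxCK realdiag_herm mulmxA. Qed.

Lemma udiag_hermsym U d : udiag U d \is hermsymmx.
Proof. exact/hermP/udiag_herm. Qed.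

Lemma udiag_spectral A : A \is hermsymmx ->
  A = udiag (spectralmx A) (map_mx (@complex.Re R) (spectral_diag A)).
Proof.
move=> hA; have /orthomx_spectralP := hermitian_normalmx hA.
rewrite (invmx_unitary (spectral_unitarymx A)) => eA; rewrite /udiag /realdiag.
suff -> : map_mx (real_complex R) (map_mx (@complex.Re R) (spectral_diag A)) =
  spectral_diag A by exact: eA.
apply/rowP => i; rewrite !mxE; apply: RRe_real.
by have /mxOverP := hermitian_spectral_diag_real hA.
Qed.

Lemma mxfun_spectral f A : mxfun f A =
  udiag (spectralmx A) (map_mx (f \o @complex.Re R) (spectral_diag A)).
Proof.
rewrite /mxfun (invmx_unitary (spectral_unitarymx A)) /udiag /realdiag.
by rewrite -map_mx_comp.
Qed.

(** The intertwining identity behind both the independence of [mxfun] from the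
choice of an eigenbasis and its Lipschitz continuity. *)
Lemma udiag_entry U V d e : U \is unitarymx -> V \is unitarymx -> forall i j,
  (V *m (udiag U d - udiag V e) *m U ^t*) i j =
  (d 0 j - e 0 i)%:C * (V *m U ^t*) i j.
Proof.
move=> Uu Vu i j; rewrite mulmxBr mulmxBl /udiag !mulmxA (unitaryKr Vu) mul1mx.
rewrite -(mulmxA _ U) (unitaryKr Uu) mulmx1 -(mulmxA (realdiag e)).
rewrite /realdiag mul_mx_diag mul_diag_mx !mxE rmorphB.
by rewrite /=; ring.
Qed.

(** Where an entry of the change of basis does not vanish, the corresponding
eigenvalues agree, hence also their images by [f]. *)
Lemma eq_udiag f U V d e : U \is unitarymx -> V \is unitarymx ->
  udiag U d = udiag V e -> udiag U (map_mx f d) = udiag V (map_mx f e).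
Proof.
move=> Uu Vu UV; apply/eqP; rewrite -subr_eq0; apply/eqP.
have -> : udiag U (map_mx f d) - udiag V (map_mx f e) = V ^t* *m (V *m
    (udiag U (map_mx f d) - udiag V (map_mx f e)) *m U ^t*) *m U.
  by rewrite !mulmxA (unitaryKl Vu) mul1mx -mulmxA (unitaryKl Uu) mulmx1.
suff -> : V *m (udiag U (map_mx f d) - udiag V (map_mx f e)) *m U ^t* = 0.
  by rewrite mulmx0 mul0mx.
apply/matrixP => i j; rewrite udiag_entry // [RHS]mxE !mxE.
have := udiag_entry d e Uu Vu i j.
rewrite UV subrr mulmx0 mul0mx mxE => /esym/eqP; rewrite mulf_eq0.
case/orP=> [/eqP[/eqP]|/eqP].
  by rewrite subr_eq0 => /eqP->; rewrite subrr rmorph0 mul0r.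
by rewrite !mxE => ->; rewrite mulr0.
Qed.

(** [mxfun] may be computed in any unitary eigenbasis. *)
Lemma mxfun_udiag f U d : U \is unitarymx ->
  mxfun f (udiag U d) = udiag U (map_mx f d).
Proof.
move=> Uu; have h := udiag_spectral (udiag_hermsym U d).
rewrite mxfun_spectral map_mx_comp.
exact/esym/(eq_udiag f Uu (spectral_unitarymx _) h).
Qed.

Lemma udiag_conj U V d : V *m udiag U d *m V ^t* = udiag (U *m V ^t*) d.
Proof. by rewrite /udiag trmxC_mul trmxCK !mulmxA. Qed.

Lemma mxfun_conj f V A : V \is unitarymx -> A \is hermsymmx ->
  mxfun f (V *m A *m V ^t*) = V *m mxfun f A *m V ^t*.
Proof.
move=> Vu /udiag_spectral; move: (spectralmx A) (spectral_unitarymx A) => U Uu ->.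
have UVu := mul_unitarymx Uu (etrans (trmxC_unitary V) Vu).
by rewrite udiag_conj (mxfun_udiag _ _ UVu) (mxfun_udiag _ _ Uu) udiag_conj.
Qed.

Lemma udiag_det U d : U \is unitarymx -> \det (udiag U d) = (\prod_i d 0 i)%:C.
Proof.
move=> Uu; rewrite /udiag !det_mulmx mulrAC -det_mulmx unitaryKl // det1 mul1r.
rewrite det_diag rmorph_prod; apply: eq_bigr => i _.
by rewrite mxE.
Qed.

Lemma udiag_trace U d : U \is unitarymx -> \tr (udiag U d) = (\sum_i d 0 i)%:C.
Proof.
move=> Uu; rewrite /udiag mxtrace_mulC mulmxA unitaryKr // mul1mx.
by rewrite mxtrace_diag rmorph_sum; apply: eq_bigr => i _; rewrite mxE.
Qed.

Lemma udiag_quad U d (x : 'cV[R[i]]_n) :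
  (x ^t* *m udiag U d *m x) 0 0 = \sum_i (d 0 i)%:C * `|(U *m x) i 0| ^+ 2.
Proof.
have -> : x ^t* *m udiag U d *m x = (U *m x) ^t* *m realdiag d *m (U *m x).
  by rewrite /udiag trmxC_mul !mulmxA.
rewrite /realdiag mul_mx_diag mxE; apply: eq_bigr => i _.
by rewrite !mxE normCK; ring.
Qed.

Lemma posdef_herm A : posdefmx A -> A \is hermsymmx.
Proof. by case. Qed.

Lemma udiag_posdef U d : U \is unitarymx ->
  posdefmx (udiag U d) <-> forall i, 0 < d 0 i.
Proof.
move=> Uu; split=> [[_ pd] i|d0].
  pose x : 'cV[R[i]]_n := U ^t* *m delta_mx i 0.
  have Ux : U *m x = delta_mx i 0 by rewrite /x mulmxA unitaryKr // mul1mx.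
  have x0 : x != 0.
    apply/eqP => x0; move: Ux; rewrite x0 mulmx0 => /matrixP/(_ i 0).
    by rewrite !mxE !eqxx => /eqP; rewrite eq_sym oner_eq0.
  have := pd x x0; rewrite udiag_quad Ux (bigD1 i) //= big1 => [|j ji].
    by rewrite !mxE !eqxx normr1 expr1n mulr1 addr0 ltcR.
  by rewrite !mxE (negbTE ji) normr0 expr0n mulr0.
split=> [|x x0]; first exact: udiag_hermsym.
rewrite udiag_quad.
have ge0 i : 0 <= (d 0 i)%:C * `|(U *m x) i 0| ^+ 2.
  by rewrite mulr_ge0 ?exprn_ge0 // ler0c ltW.
rewrite lt_def sumr_ge0 // andbT psumr_eq0 //; apply: contra x0 => /allP h.
suff Ux : U *m x = 0.
  by rewrite -[x]mul1mx -(unitaryKl Uu) -mulmxA Ux mulmx0.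
apply/matrixP => i j; rewrite ord1 [RHS]mxE.
have := h i; rewrite mem_index_enum => /(_ isT); rewrite /= mulf_eq0.
rewrite expf_eq0 /= normr_eq0 => /orP[|/eqP //].
by rewrite gt_eqF // ltcR.
Qed.

Lemma posdefP A : posdefmx A ->
  exists U d, [/\ U \is unitarymx, forall i, 0 < d 0 i & A = udiag U d].
Proof.
move=> pA; have hA := udiag_spectral (posdef_herm pA).
exists (spectralmx A), (map_mx (@complex.Re R) (spectral_diag A)).
split=> //; first exact: spectral_unitarymx.
by apply/(udiag_posdef _ (spectral_unitarymx A)); rewrite -hA.
Qed.

Lemma hermE A : A \is hermsymmx ->
  exists U d, U \is unitarymx /\ A = udiag U d.
Proof.
move=> hA; exists (spectralmx A), (map_mx (@complex.Re R) (spectral_diag A)).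
by split; [exact: spectral_unitarymx | exact: udiag_spectral].
Qed.

Lemma udiag_inv U d : U \is unitarymx -> (forall i, d 0 i != 0) ->
  udiag U d \in unitmx /\ invmx (udiag U d) = udiag U (map_mx GRing.inv d).
Proof.
move=> Uu d0; have h : udiag U d *m udiag U (map_mx GRing.inv d) = 1%:M.
  rewrite (udiagM _ _ Uu) -(udiag1 Uu); congr udiag.
  by apply/rowP => i; rewrite !mxE divff.
by have [u _] := mulmx1_unit h; split=> //; rewrite -[RHS](mulKmx u) h mulmx1.
Qed.

Lemma posdef_unit A : posdefmx A -> A \in unitmx.
Proof.
move=> /posdefP[U [d [Uu d0 ->]]]; apply: (udiag_inv Uu _).1 => i.
by rewrite gt_eqF.
Qed.

Lemma posdef_inv A : posdefmx A -> posdefmx (invmx A).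
Proof.
move=> /posdefP[U [d [Uu d0 ->]]]; rewrite (udiag_inv Uu _).2 => [|i].
  by apply/udiag_posdef => // i; rewrite mxE invr_gt0.
by rewrite gt_eqF.
Qed.

Lemma posdef_congr A S : posdefmx A -> S \in unitmx ->
  posdefmx (S ^t* *m A *m S).
Proof.
move=> [/hermP hA pA] Su; split.
  by apply/hermP; rewrite !trmxC_mul trmxCK hA mulmxA.
move=> x x0; have -> : x ^t* *m (S ^t* *m A *m S) *m x = (S *m x) ^t* *m A *m (S *m x).
  by rewrite trmxC_mul !mulmxA.
apply: pA; apply: contra x0 => /eqP Sx.
by rewrite -[x](mulKmx Su) Sx mulmx0.
Qed.

Lemma posdef_congr_herm A S : posdefmx A -> posdefmx S ->
  posdefmx (S *m A *m S).
Proof.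
move=> pA pS; have := posdef_congr pA (posdef_unit pS).
by have /hermP -> := posdef_herm pS.
Qed.

Lemma posdef_mxpow A t : posdefmx A -> posdefmx (mxpow A t).
Proof.
move=> /posdefP[U [d [Uu d0 ->]]]; rewrite /mxpow (mxfun_udiag _ _ Uu).
by apply/udiag_posdef => // i; rewrite mxE powR_gt0.
Qed.

Lemma mxpowD A s t : posdefmx A -> mxpow A s *m mxpow A t = mxpow A (s + t).
Proof.
move=> /posdefP[U [d [Uu d0 ->]]]; rewrite /mxpow !(mxfun_udiag _ _ Uu) (udiagM _ _ Uu).
congr udiag; apply/rowP => i; rewrite !mxE powRD //.
by rewrite (gt_eqF (d0 i)) implybT.
Qed.

Lemma mxpow0 A : posdefmx A -> mxpow A 0 = 1%:M.
Proof.
move=> /posdefP[U [d [Uu d0 ->]]]; rewrite /mxpow (mxfun_udiag _ _ Uu) -(udiag1 Uu).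
by congr udiag; apply/rowP => i; rewrite !mxE powRr0.
Qed.

Lemma mxpow1 A : posdefmx A -> mxpow A 1 = A.
Proof.
move=> /posdefP[U [d [Uu d0 ->]]]; rewrite /mxpow (mxfun_udiag _ _ Uu).
by congr udiag; apply/rowP => i; rewrite !mxE powRr1 // ltW.
Qed.

Lemma mxpow_half A : posdefmx A -> mxpow A 2^-1 *m mxpow A 2^-1 = A.
Proof.
move=> pA; rewrite mxpowD // (_ : _ + _ = 1) ?mxpow1 //.
by field.
Qed.

Lemma mxpow_halfV A : posdefmx A -> mxpow A (- 2^-1) *m mxpow A 2^-1 = 1%:M.
Proof. by move=> pA; rewrite mxpowD // addNr mxpow0. Qed.

Lemma mxpow_halfK A : posdefmx A -> mxpow A 2^-1 *m mxpow A (- 2^-1) = 1%:M.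
Proof. by move=> pA; rewrite mxpowD // subrr mxpow0. Qed.

Lemma mxsqrt_unique A : posdefmx A -> mxpow (A *m A) 2^-1 = A.
Proof.
move=> /posdefP[U [d [Uu d0 ->]]]; rewrite (udiagM _ _ Uu) /mxpow (mxfun_udiag _ _ Uu).
congr udiag; apply/rowP => i; rewrite !mxE -expr2 -powR_mulrn ?ltW //.
by rewrite -powRrM mulfV ?powRr1 ?ltW ?pnatr_eq0.
Qed.

Lemma mxlog_inv A : posdefmx A -> mxlog (invmx A) = - mxlog A.
Proof.
move=> /posdefP[U [d [Uu d0 ->]]]; rewrite (udiag_inv Uu _).2 => [|i]; last first.
  by rewrite gt_eqF.
rewrite /mxlog !(mxfun_udiag _ _ Uu) /udiag -mulNmx -mulmxN; congr (_ *m _ *m _).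
rewrite /realdiag -raddfN; congr diag_mx.
by apply/rowP => i; rewrite !mxE lnV ?rmorphN // posrE.
Qed.

Lemma unitarymx1 : (1%:M : 'M[R[i]]_n) \is unitarymx.
Proof. by apply/unitarymxP; rewrite trmx1 map_mx1 mulmx1. Qed.

Lemma mxpow1mx t : mxpow (1%:M : 'M[R[i]]_n) t = 1%:M.
Proof.
have u1 := unitarymx1; rewrite -{1}(udiag1 u1) /mxpow (mxfun_udiag _ _ u1).
rewrite -[RHS](udiag1 u1).
by congr udiag; apply/rowP => i; rewrite !mxE powR1.
Qed.

Lemma posdef1 : posdefmx (1%:M : 'M[R[i]]_n).
Proof.
have u1 := unitarymx1; by rewrite -(udiag1 u1); apply/udiag_posdef => // i; rewrite mxE.
Qed.

Lemma posdef_scale (a : R) A : 0 < a -> posdefmx A -> posdefmx (a%:C *: A).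
Proof.
move=> a0 [/hermP hA pA]; split.
  by apply/hermP; rewrite linearZ /= map_mxZ hA; congr (_ *: _); exact: conj_realC.
move=> x x0; rewrite -scalemxAr -scalemxAl mxE mulr_gt0 ?ltcR //.
exact: pA.
Qed.

End FunctionalCalculus.

(** * The geometric mean and the Riccati equation *)
Section GeometricMean.
Variables (R : realType) (n : nat).
Implicit Types (A B S T U V X : 'M[R[i]]_n) (d e : 'rV[R]_n).

Lemma geomean_posdef A B : posdefmx A -> posdefmx B -> posdefmx (geomean A B).
Proof.
move=> pA pB; rewrite /geomean.
have ph := posdef_mxpow 2^-1 pA; have pk := posdef_mxpow (- 2^-1) pA.
exact: posdef_congr_herm (posdef_mxpow _ (posdef_congr_herm pB pk)) ph.
Qed.

(** With [x] the square root of [X], the matrix [x T x] is a positive definite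
square root of [x (T X T) x]. *)
Lemma riccati_unique X T T' : posdefmx X -> posdefmx T -> posdefmx T' ->
  T *m X *m T = T' *m X *m T' -> T = T'.
Proof.
move=> pX pT pT' TT'.
move: (mxpow X _) (posdef_mxpow 2^-1 pX) (mxpow_half pX) => x px xx.
have xu := posdef_unit px.
have sq S : (x *m S *m x) *m (x *m S *m x) = x *m (S *m X *m S) *m x.
  by rewrite -xx !mulmxA.
have : x *m T *m x = x *m T' *m x.
  have h1 := mxsqrt_unique (posdef_congr_herm pT px).
  have h2 := mxsqrt_unique (posdef_congr_herm pT' px).
  by apply: etrans (esym h1) (etrans _ h2); rewrite !sq TT'.
by move=> /(can_inj (mulmxK xu))/(can_inj (mulKmx xu)).
Qed.

Lemma geomean_riccati A X : posdefmx A -> posdefmx X ->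
  geomean A (invmx X) *m X *m geomean A (invmx X) = A.
Proof.
move=> pA pX; have pV := posdef_inv pX.
rewrite /geomean; have hh := mxpow_half pA; have kh := mxpow_halfV pA; have hk := mxpow_halfK pA.
have pk := posdef_mxpow (- 2^-1) pA.
have ss := mxpow_half (posdef_congr_herm pV pk).
have ps := posdef_mxpow 2^-1 (posdef_congr_herm pV pk).
move: (mxpow (_ *m _ *m _) _) ss ps => s ss ps.
move: (mxpow A 2^-1) (mxpow A (- 2^-1)) hh kh hk pk ss => h k hh kh hk pk ss.
have su := posdef_unit ps.
have key : s *m (h *m X *m h) *m s = 1%:M.
  suff : (s *m s) *m (h *m X *m h) = 1%:M.
    rewrite -!mulmxA => /mulmx1C; rewrite !mulmxA => e.
    by rewrite -(mulmxA s) !mulmxA.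
  rewrite ss !mulmxA -(mulmxA _ k h) kh mulmx1 -(mulmxA k) mulVmx ?posdef_unit //.
  by rewrite mulmx1.
transitivity (h *m (s *m (h *m X *m h) *m s) *m h); first by rewrite !mulmxA.
by rewrite key mulmx1.
Qed.

Local Opaque geomean mxfun invmx posdefmx.

Lemma geomeanE A X T : posdefmx A -> posdefmx X ->
  posdefmx T -> T *m X *m T = A -> geomean A (invmx X) = T.
Proof.
move=> pA pX pT TXT; have pG := geomean_posdef pA (posdef_inv pX).
exact: riccati_unique pX pG pT (etrans (geomean_riccati pA pX) (esym TXT)).
Qed.

Lemma geomean_scale (a : R) A X : 0 < a -> posdefmx A -> posdefmx X ->
  geomean (a%:C *: A) (invmx (a%:C *: X)) = geomean A (invmx X).
Proof.
move=> a0 pA pX; have pG := geomean_posdef pA (posdef_inv pX).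
apply: (geomeanE (posdef_scale a0 pA) (posdef_scale a0 pX) pG).
by rewrite -scalemxAr -scalemxAl geomean_riccati.
Qed.

Lemma posdef_unitary_conj U A : U \is unitarymx -> posdefmx A ->
  posdefmx (U *m A *m U ^t*).
Proof.
move=> Uu pA; rewrite -[U in U *m A]trmxCK.
by apply: (posdef_congr pA); rewrite unitarymx_unit ?trmxC_unitary.
Qed.

Lemma geomean_unitary U A X : U \is unitarymx -> posdefmx A -> posdefmx X ->
  geomean (U *m A *m U ^t*) (invmx (U *m X *m U ^t*)) =
  U *m geomean A (invmx X) *m U ^t*.
Proof.
move=> Uu pA pX; have pG := geomean_posdef pA (posdef_inv pX).
apply: (geomeanE (posdef_unitary_conj Uu pA) (posdef_unitary_conj Uu pX)
  (posdef_unitary_conj Uu pG)).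
move: (geomean A (invmx X)) (geomean_riccati pA pX) => G <-.
transitivity (U *m G *m (U ^t* *m U) *m X *m (U ^t* *m U) *m G *m U ^t*).
  by rewrite !mulmxA.
by rewrite (unitaryKl Uu) !mulmx1 !mulmxA.
Qed.

Lemma geomean_inv A X : posdefmx A -> posdefmx X ->
  geomean (invmx A) (invmx (invmx X)) = invmx (geomean A (invmx X)).
Proof.
move=> pA pX; have pG := geomean_posdef pA (posdef_inv pX).
apply: (geomeanE (posdef_inv pA) (posdef_inv pX) (posdef_inv pG)).
have hG := geomean_riccati pA pX; move: (geomean A _) pG hG => G pG hG.
have Gu := posdef_unit pG; have Xu := posdef_unit pX; have Au := posdef_unit pA.
suff h : invmx G *m invmx X *m invmx G *m A = 1%:M.
  by rewrite -[LHS](mulmxK Au) h mul1mx.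
by rewrite -hG -!mulmxA (mulKmx Gu) (mulKmx Xu) mulVmx.
Qed.

Lemma posdef_det T : posdefmx T ->
  exists2 t : R, 0 < t & \det T = t%:C /\ \tr (mxlog T) = (ln t)%:C.
Proof.
move=> /posdefP[U [d [Uu d0 ->]]]; exists (\prod_i d 0 i).
  by apply: prodr_gt0.
split; first exact: udiag_det.
rewrite /mxlog (mxfun_udiag _ _ Uu) (udiag_trace _ Uu); congr _%:C.
rewrite (eq_bigr (fun i => ln (d 0 i))) => [|i _]; last by rewrite mxE.
suff [] : \sum_i ln (d 0 i) = ln (\prod_i d 0 i) /\ 0 < \prod_i d 0 i by [].
elim/big_rec2: _ => [|i x y _ [-> y0]]; first by rewrite ln1.
by rewrite lnM ?posrE // mulr_gt0.
Qed.

(** Commuting matrices have a common unitary triangularization, and a hermitian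
triangular matrix is diagonal. *)
Lemma codiagonalization m (A : 'I_m -> 'M[R[i]]_n) :
  (forall i, A i \is hermsymmx) -> (forall i j, A i *m A j = A j *m A i) ->
  exists2 U, U \is unitarymx & exists d : 'I_m -> 'rV[R]_n,
    forall i, A i = udiag U (d i).
Proof.
move=> hA cA; have [|U Uu /allP trigU] := @cotrigonalization _ n [seq A i | i : 'I_m].
  by move=> _ _ /mapP[i _ ->] /mapP[j _ ->]; exact: cA.
exists U => //.
have diagA i : exists d, A i = udiag U d.
  have : similar_trig U (A i) by apply: trigU; apply: map_f; rewrite mem_enum.
  rewrite /similar_to /= (conjymx _ Uu).
  have [D eD] : exists D, D = U *m A i *m U ^t* by exists (U *m A i *m U ^t*).
  rewrite -eD => /is_trig_mxP trigD.
  have hD : D ^t* = D.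
    by rewrite eD !trmxC_mul trmxCK ((hermP _).1 (hA i)) mulmxA.
  have Dherm a b : D a b = Num.conj (D b a) by rewrite -{1}hD !mxE.
  exists (\row_j complex.Re (D j j)); rewrite /udiag.
  have -> : realdiag (\row_j complex.Re (D j j)) = D.
    apply/matrixP => a b; rewrite !mxE; have [->|ab] := eqVneq a b.
      by rewrite mulr1n RRe_real //; apply/CrealP; exact: esym (Dherm b b).
    rewrite mulr0n; case: (ltngtP a b) => [lt_ab|lt_ba|/val_inj /eqP].
    - by rewrite trigD.
    - by rewrite Dherm (trigD _ _ lt_ba) rmorph0.
    - by rewrite (negbTE ab).
  by rewrite eD !mulmxA (unitaryKl Uu) mul1mx -mulmxA (unitaryKl Uu) mulmx1.
by have [d hd] := choice diagA; exists d.
Qed.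

Lemma big_mulmx_udiag m U (e : 'I_m -> 'rV[R]_n) : U \is unitarymx ->
  \big[mulmx/1%:M]_(i < m) udiag U (e i) = udiag U (\row_j \prod_(i < m) e i 0 j).
Proof.
move=> Uu; elim: m e => [|m IH] e.
  rewrite big_ord0 -(udiag1 Uu); congr udiag.
  by apply/rowP => j; rewrite !mxE big_ord0.
rewrite big_ord_recl IH (udiagM _ _ Uu); congr udiag.
by apply/rowP => j; rewrite !mxE big_ord_recl.
Qed.

Lemma sum_scale_udiag m U (w : 'I_m -> R) (e : 'I_m -> 'rV[R]_n) :
  \sum_i (w i)%:C *: udiag U (e i) = udiag U (\row_j \sum_(i < m) w i * e i 0 j).
Proof.
rewrite /udiag; under eq_bigr do rewrite scalemxAl scalemxAr.
rewrite -mulmx_suml -mulmx_sumr; congr (_ *m _ *m _).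
apply/matrixP => a b; rewrite summxE !mxE; have [->|ab] := eqVneq a b.
  rewrite mulr1n rmorph_sum; apply: eq_bigr => i _.
  by rewrite !mxE eqxx mulr1n rmorphM.
by rewrite mulr0n big1 // => i _; rewrite !mxE (negbTE ab) mulr0n mulr0.
Qed.

Lemma geomean_udiag U d (x : 'rV[R]_n) : U \is unitarymx -> (forall i, 0 < d 0 i) ->
  (forall i, 0 < x 0 i) -> geomean (udiag U d) (invmx (udiag U x)) =
  udiag U (\row_i ((d 0 i / x 0 i) `^ 2^-1)).
Proof.
move=> Uu d0 x0; have y0 i : 0 < (\row_i ((d 0 i / x 0 i) `^ 2^-1)) 0 i.
  by rewrite mxE powR_gt0 // divr_gt0.
apply: (geomeanE ((udiag_posdef _ Uu).2 d0) ((udiag_posdef _ Uu).2 x0)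
  ((udiag_posdef _ Uu).2 y0)).
rewrite !(udiagM _ _ Uu); congr udiag; apply/rowP => i; rewrite !mxE.
rewrite mulrAC -powRD; last by rewrite (gt_eqF (divr_gt0 (d0 i) (x0 i))) implybT.
rewrite (_ : _ + _ = 1); last by field.
by rewrite powRr1 ?divfK ?gt_eqF // ltW // divr_gt0.
Qed.

End GeometricMean.

(** * Properties of the solution set *)
Section GammaProperties.
Local Opaque geomean mxfun invmx posdefmx.
Variables (R : realType) (n m : nat).
Implicit Types (w : 'I_m -> R) (A : 'I_m -> 'M[R[i]]_n) (X U : 'M[R[i]]_n).

Lemma GammaE m' (w : 'I_m' -> R) (A : 'I_m' -> 'M[R[i]]_n) X : Gamma w A X <->
  posdefmx X /\ \sum_i (w i)%:C *: mxlog (geomean (A i) (invmx X)) = 0.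
Proof.
have E (B : 'M[R[i]]_n) : mxpow 1%:M (- 2^-1) *m B *m mxpow 1%:M (- 2^-1) = B.
  by rewrite mxpow1mx mul1mx mulmx1.
have sumE : \sum_i (w i)%:C *: mxlog (mxpow 1%:M (- 2^-1) *m
    geomean (A i) (invmx X) *m mxpow 1%:M (- 2^-1)) =
    \sum_i (w i)%:C *: mxlog (geomean (A i) (invmx X)).
  by apply: eq_bigr => i _; rewrite E.
split=> [[pX [_ h]]|[pX h]]; first exact: conj pX (etrans (esym sumE) h).
exact: conj pX (conj (posdef1 _ _) (etrans sumE h)).
Qed.

Lemma Gamma_commuting w A : prob_weights w -> (forall i, posdefmx (A i)) ->
  (forall i j, A i *m A j = A j *m A i) ->
  Gamma w A (\big[mulmx/1%:M]_(i < m) mxpow (A i) (w i)).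
Proof.
move=> [_ sw] pA cA.
have [U Uu [d hd]] := codiagonalization (fun i => posdef_herm (pA i)) cA.
have pU i : posdefmx (udiag U (d i)) by rewrite -hd.
have d0 i : forall j, 0 < d i 0 j := (udiag_posdef _ Uu).1 (pU i).
pose x := \row_j \prod_(i < m) (map_mx (fun z : R => z `^ w i) (d i)) 0 j.
have x0 j : 0 < x 0 j by rewrite mxE prodr_gt0 // => i _; rewrite mxE powR_gt0.
have -> : \big[mulmx/1%:M]_(i < m) mxpow (A i) (w i) = udiag U x.
  rewrite -(big_mulmx_udiag _ Uu); apply: eq_bigr => i _.
  by rewrite hd /mxpow mxfun_udiag.
have lnx j : ln (x 0 j) = \sum_i w i * ln (d i 0 j).
  rewrite mxE (eq_bigr (fun i => expR (w i * ln (d i 0 j)))) => [|i _].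
    by rewrite -expR_sum expRK.
  by rewrite mxE /powR gt_eqF.
clearbody x.
apply/GammaE; split; first exact: (udiag_posdef _ Uu).2 x0.
rewrite (eq_bigr (fun i => (w i)%:C *:
    udiag U (\row_j (2^-1 * (ln (d i 0 j) - ln (x 0 j)))))); last first.
  move=> i _; congr (_ *: _); rewrite hd (geomean_udiag Uu (d0 i) x0) /mxlog (mxfun_udiag _ _ Uu).
  by congr udiag; apply/rowP => j; rewrite !mxE ln_powR ln_div ?posrE.
rewrite sum_scale_udiag (_ : \row__ _ = 0).
  rewrite /udiag /realdiag map_mx0 (_ : diag_mx 0 = 0) ?mulmx0 ?mul0mx //.
  by apply/matrixP => a b; rewrite !mxE mul0rn.
apply/rowP => j; rewrite !mxE.
rewrite (eq_bigr (fun i => 2^-1 * (w i * ln (d i 0 j) - w i * ln (x 0 j)))).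
  by rewrite -mulr_sumr sumrB -mulr_suml sw mul1r lnx subrr mulr0.
by move=> i _; rewrite !mxE; ring.
Qed.

Lemma Gamma_scale w A (a : R) X : 0 < a -> (forall i, posdefmx (A i)) ->
  Gamma w A X -> Gamma w (fun i => a%:C *: A i) (a%:C *: X).
Proof.
move=> a0 pA /GammaE[pX h]; apply/GammaE; split; first exact: posdef_scale a0 pX.
by rewrite -[RHS]h; apply: eq_bigr => i _; rewrite (geomean_scale a0 (pA i) pX).
Qed.

Lemma eq_Gamma m1 m2 (w1 : 'I_m1 -> R) (w2 : 'I_m2 -> R)
    (A1 : 'I_m1 -> 'M[R[i]]_n) (A2 : 'I_m2 -> 'M[R[i]]_n) :
  (forall X, \sum_i (w1 i)%:C *: mxlog (geomean (A1 i) (invmx X)) =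
             \sum_i (w2 i)%:C *: mxlog (geomean (A2 i) (invmx X))) ->
  Gamma w1 A1 = Gamma w2 A2.
Proof.
move=> e; apply/seteqP; split=> X /GammaE[pX h]; apply/GammaE.
  exact: conj pX (etrans (esym (e X)) h).
exact: conj pX (etrans (e X) h).
Qed.

Lemma Gamma_perm w A (s : 'S_m) :
  Gamma (fun i => w (s i)) (fun i => A (s i)) = Gamma w A.
Proof.
apply: eq_Gamma => X.
by rewrite [RHS](reindex_inj (@perm_inj _ s)).
Qed.

Lemma sum_block_index (V : zmodType) (k : nat) (F : 'I_m -> V) :
  \sum_(i < m * k) F (block_index i) = (\sum_(j < m) F j) *+ k.
Proof.
have hlt (p : 'I_k * 'I_m) : (p.1 * m + p.2 < m * k)%N.
  by rewrite (mulnC m) (leq_trans _ (leq_mul (ltn_ord p.1) (leqnn m))) //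
    mulSn addnC ltn_add2r ltn_ord.
have hdiv (i : 'I_(m * k)) : (i %/ m < k)%N.
  have := leq_ltn_trans (leq0n i) (ltn_ord i); rewrite muln_gt0 => /andP[m0 _].
  by rewrite ltn_divLR // [X in (_ < X)%N]mulnC ltn_ord.
rewrite (reindex (fun p => Ordinal (hlt p))) /=; last first.
  exists (fun i => (Ordinal (hdiv i), block_index i)) => [[l j] _|i _].
    have m0 : (0 < m)%N by exact: leq_ltn_trans (leq0n j) (ltn_ord j).
    congr pair; apply: val_inj => /=.
      by rewrite divnMDl // divn_small ?addn0.
    by rewrite modnMDl modn_small.
  by apply: val_inj => /=; rewrite -divn_eq.
rewrite (eq_bigr (fun p => F p.2)) => [|[l j] _].
  by rewrite -(pair_bigA _ (fun _ j => F j)) /= sumr_const card_ord.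
by congr F; apply: val_inj; rewrite /= modnMDl modn_small.
Qed.

Lemma Gamma_repeat w A (k : nat) : (0 < k)%N ->
  Gamma (repeat_weights (k := k) w) (repeat_tuple (k := k) A) = Gamma w A.
Proof.
move=> k0; have sumE X :
    \sum_i (repeat_weights (k := k) w i)%:C *:
      mxlog (geomean (repeat_tuple (k := k) A i) (invmx X)) =
    \sum_i (w i)%:C *: mxlog (geomean (A i) (invmx X)).
  rewrite /repeat_weights /repeat_tuple.
  rewrite (sum_block_index k (fun i => (k%:R^-1 * w i)%:C *:
    mxlog (geomean (A i) (invmx X)))) -sumrMnl; apply: eq_bigr => i _.
  rewrite scalerMnl -rmorphMn /= -mulrnAl -[_ *+ k]mulr_natr mulVf ?mul1r //.
  by rewrite pnatr_eq0 -lt0n.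
exact: eq_Gamma sumE.
Qed.

Lemma Gamma_unitary w A U X : U \is unitarymx -> (forall i, posdefmx (A i)) ->
  Gamma w A X -> Gamma w (fun i => U *m A i *m U ^t*) (U *m X *m U ^t*).
Proof.
move=> Uu pA /GammaE[pX h]; apply/GammaE; split; first exact: posdef_unitary_conj Uu pX.
transitivity (U *m 0 *m U ^t*); last by rewrite mulmx0 mul0mx.
rewrite -[in RHS]h mulmx_sumr mulmx_suml; apply: eq_bigr => i _.
have hG := posdef_herm (geomean_posdef (pA i) (posdef_inv pX)).
by rewrite (geomean_unitary Uu (pA i) pX) /mxlog (mxfun_conj _ Uu hG) -scalemxAr -scalemxAl.
Qed.

Lemma Gamma_inv w A X : (forall i, posdefmx (A i)) ->
  Gamma w A X -> Gamma w (fun i => invmx (A i)) (invmx X).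
Proof.
move=> pA /GammaE[pX h]; apply/GammaE; split; first exact: posdef_inv pX.
rewrite -[RHS]oppr0 -[in RHS]h -sumrN; apply: eq_bigr => i _.
have pG := geomean_posdef (pA i) (posdef_inv pX).
by rewrite (geomean_inv (pA i) pX) (mxlog_inv pG) scalerN.
Qed.

(** With [t i] the determinant of the solution of the Riccati equation for [A i],
the trace of the defining equation says [sum w i ln (t i) = 0]; it remains to
weight [det (A i) = (t i)^2 det X] geometrically. *)
Lemma Gamma_det w A X : prob_weights w -> (forall i, posdefmx (A i)) ->
  Gamma w A X ->
  \det X = \prod_(i < m) ((complex.Re (\det (A i))) `^ (w i))%:C.
Proof.
move=> [_ sw] pA /GammaE[pX h]; pose T i := geomean (A i) (invmx X).
have pT i : posdefmx (T i) := geomean_posdef (pA i) (posdef_inv pX).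
have [x x0 [dX _]] := posdef_det pX.
have [t ht] := choice (fun i => let: ex_intro2 t h1 h2 := posdef_det (pT i) in
  ex_intro (fun t => 0 < t /\ (\det (T i) = t%:C /\ \tr (mxlog (T i)) = (ln t)%:C))
    t (conj h1 h2)).
have st : \sum_i w i * ln (t i) = 0.
  apply: (@complexI R); rewrite rmorph_sum rmorph0.
  transitivity (\tr (0 : 'M[R[i]]_n)); last by rewrite mxtrace0.
  rewrite -h raddf_sum; apply: eq_bigr => i _.
  by have [_ [_ tr]] := ht i; rewrite /= mxtraceZ tr rmorphM.
have dA i : complex.Re (\det (A i)) = t i * x * t i.
  have [_ [dT _]] := ht i.
  have := geomean_riccati (pA i) pX; rewrite -/(T i).
  by move: (T i) dT => G dG <-; rewrite !det_mulmx dG dX -!rmorphM.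
rewrite -rmorph_prod dX; congr _%:C.
rewrite (eq_bigr (fun i => expR (w i * ln (t i) *+ 2 + w i * ln x))) => [|i _].
  rewrite -expR_sum big_split /= sumrMnl st mul0rn add0r -mulr_suml sw mul1r.
  by rewrite lnK // posrE.
have [ti _] := ht i.
rewrite dA /powR gt_eqF ?mulr_gt0 // !lnM ?posrE ?mulr_gt0 //.
by congr expR; ring.
Qed.

End GammaProperties.

(** * The entrywise l1 norm *)
Section L1Norm.
Variable R : realType.

Definition cnorm (z : R[i]) : R := complex.Re `|z|.

Lemma cnormE z : (cnorm z)%:C = `|z|.
Proof. by rewrite /cnorm RRe_real // normr_real. Qed.

Lemma cnorm_ge0 z : 0 <= cnorm z.
Proof. by rewrite -lecR cnormE normr_ge0. Qed.

Lemma cnormM y z : cnorm (y * z) = cnorm y * cnorm z.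
Proof. by apply: (@complexI R); rewrite rmorphM /= !cnormE normrM. Qed.

Lemma cnormN z : cnorm (- z) = cnorm z.
Proof. by rewrite /cnorm normrN. Qed.

Lemma cnorm_real (x : R) : cnorm x%:C = `|x|.
Proof.
apply: (@complexI R); rewrite cnormE normc_def /= expr0n addr0.
by rewrite sqrtr_sqr.
Qed.

Lemma cnorm_sum (I : Type) (r : seq I) (P : pred I) (F : I -> R[i]) :
  cnorm (\sum_(i <- r | P i) F i) <= \sum_(i <- r | P i) cnorm (F i).
Proof.
rewrite -lecR cnormE rmorph_sum; apply: le_trans (ler_norm_sum _ _ _) _.
by apply: ler_sum => i _; rewrite -cnormE.
Qed.

Lemma cnormD y z : cnorm (y + z) <= cnorm y + cnorm z.
Proof. by rewrite -lecR rmorphD /= !cnormE ler_normD. Qed.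

Lemma cnorm_conj z : cnorm (Num.conj z) = cnorm z.
Proof. by rewrite /cnorm norm_conjC. Qed.

Lemma cnorm_eq0 z : cnorm z = 0 -> z = 0.
Proof. by move/(congr1 (real_complex R)); rewrite cnormE => /eqP; rewrite normr_eq0 => /eqP. Qed.

Lemma cnorm_sqr z : (cnorm z ^+ 2)%:C = `|z| ^+ 2.
Proof. by rewrite rmorphXn /= cnormE. Qed.

Lemma ReD (y z : R[i]) : complex.Re (y + z) = complex.Re y + complex.Re z.
Proof. by case: y z => [a b] [c d]. Qed.

Lemma ReN (z : R[i]) : complex.Re (- z) = - complex.Re z.
Proof. by case: z. Qed.

Lemma Re_sum (I : Type) (r : seq I) (P : pred I) (F : I -> R[i]) :
  complex.Re (\sum_(i <- r | P i) F i) = \sum_(i <- r | P i) complex.Re (F i).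
Proof. by apply: (big_morph _ ReD). Qed.

Lemma ReZ (x : R) (z : R[i]) : complex.Re (x%:C * z) = x * complex.Re z.
Proof. by case: z => a b /=; rewrite mul0r subr0. Qed.

Lemma le_Re_cnorm z : `|complex.Re z| <= cnorm z.
Proof. by rewrite -lecR cnormE normc_ge_Re. Qed.

Lemma cnorm_le_ReIm z : cnorm z <= `|complex.Re z| + `|complex.Im z|.
Proof.
rewrite -lecR cnormE normc_def lecR; case: z => a b /=.
rewrite -[leRHS]ger0_norm ?addr_ge0 // -sqrtr_sqr ler_wsqrtr //.
rewrite sqrrD !real_normK ?num_real // addrAC lerDl mulrn_wge0 //.
by rewrite mulr_ge0.
Qed.

Definition l1norm m p (X : 'M[R[i]]_(m, p)) : R := \sum_i \sum_j cnorm (X i j).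

Lemma l1norm_ge0 m p (X : 'M[R[i]]_(m, p)) : 0 <= l1norm X.
Proof. by do 2!apply: sumr_ge0 => ? _; exact: cnorm_ge0. Qed.

Lemma le_l1norm m p (X : 'M[R[i]]_(m, p)) i j : cnorm (X i j) <= l1norm X.
Proof.
rewrite /l1norm (bigD1 i) //= (bigD1 j) //= -addrA lerDl.
by rewrite addr_ge0 // !sumr_ge0 // => *; rewrite ?sumr_ge0 // => *; exact: cnorm_ge0.
Qed.

Lemma l1norm_eq0 m p (X : 'M[R[i]]_(m, p)) : l1norm X <= 0 -> X = 0.
Proof.
move=> X0; apply/matrixP => i j; rewrite [RHS]mxE; apply: cnorm_eq0; apply/eqP.
by rewrite eq_le cnorm_ge0 andbT (le_trans (le_l1norm X i j)).
Qed.

Lemma l1normD m p (X Y : 'M[R[i]]_(m, p)) : l1norm (X + Y) <= l1norm X + l1norm Y.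
Proof.
rewrite /l1norm -big_split /=; apply: ler_sum => i _.
by rewrite -big_split /=; apply: ler_sum => j _; rewrite mxE cnormD.
Qed.

Lemma l1normN m p (X : 'M[R[i]]_(m, p)) : l1norm (- X) = l1norm X.
Proof. by do 2!apply: eq_bigr => ? _; rewrite mxE cnormN. Qed.

Lemma l1norm0 m p : l1norm (0 : 'M[R[i]]_(m, p)) = 0.
Proof.
rewrite /l1norm big1 // => i _; rewrite big1 // => j _.
by rewrite mxE (cnorm_real 0) normr0.
Qed.

Lemma l1norm_sum m p (I : Type) (r : seq I) (P : pred I) (F : I -> 'M[R[i]]_(m, p)) :
  l1norm (\sum_(i <- r | P i) F i) <= \sum_(i <- r | P i) l1norm (F i).
Proof.
elim/big_rec2: _ => [|i x y _ h]; first by rewrite l1norm0.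
by apply: le_trans (l1normD _ _) _; rewrite lerD2l.
Qed.

Lemma l1normZ m p (a : R) (X : 'M[R[i]]_(m, p)) : l1norm (a%:C *: X) = `|a| * l1norm X.
Proof.
rewrite /l1norm mulr_sumr; apply: eq_bigr => i _; rewrite mulr_sumr.
by apply: eq_bigr => j _; rewrite mxE cnormM cnorm_real.
Qed.

Lemma l1normM m p q (X : 'M[R[i]]_(m, p)) (Y : 'M[R[i]]_(p, q)) :
  l1norm (X *m Y) <= l1norm X * l1norm Y.
Proof.
rewrite {1 2}/l1norm mulr_suml; apply: ler_sum => i _.
rewrite mulr_suml; apply: (@le_trans _ _ (\sum_j \sum_k cnorm (X i k) * cnorm (Y k j))).
  apply: ler_sum => j _; rewrite mxE; apply: le_trans (cnorm_sum _ _ _) _.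
  by apply: ler_sum => k _; rewrite cnormM.
rewrite exchange_big /=; apply: ler_sum => k _; rewrite -mulr_sumr.
rewrite ler_wpM2l ?cnorm_ge0 // /l1norm [leRHS](bigD1 k) //= lerDl.
by do 2!apply: sumr_ge0 => ? _; exact: cnorm_ge0.
Qed.

Lemma Re_tr_l1norm n (X : 'M[R[i]]_n) : `|complex.Re (\tr X)| <= l1norm X.
Proof.
rewrite /mxtrace Re_sum; apply: le_trans (ler_norm_sum _ _ _) _.
apply: ler_sum => i _; apply: le_trans (le_Re_cnorm _) _.
by rewrite (bigD1 i) //= lerDl sumr_ge0 // => *; exact: cnorm_ge0.
Qed.

End L1Norm.

Section L1Calculus.
Variables (R : realType) (n : nat).
Implicit Types (A B S T U V : 'M[R[i]]_n) (d e : 'rV[R]_n) (f : R -> R).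

Lemma unitary_adj U : U \is unitarymx -> U ^t* \is unitarymx.
Proof. by move=> Uu; exact: (etrans (trmxC_unitary U) Uu). Qed.

Lemma unitary_row_sum U i : U \is unitarymx -> \sum_j cnorm (U i j) ^+ 2 = 1.
Proof.
move=> Uu; apply: (@complexI R); rewrite rmorph_sum rmorph1 /=.
have := congr1 (fun M : 'M_n => M i i) (unitaryKr Uu).
rewrite !mxE eqxx => h; apply: etrans h; apply: eq_bigr => j _.
by rewrite cnorm_sqr normCK !mxE.
Qed.

Lemma unitary_entry_le1 U i j : U \is unitarymx -> cnorm (U i j) <= 1.
Proof.
move=> Uu; have := unitary_row_sum i Uu; rewrite (bigD1 j) //= => h.
rewrite -(@expr_le1 _ 2) ?cnorm_ge0 // -h lerDl sumr_ge0 // => k _.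
by rewrite exprn_ge0 ?cnorm_ge0.
Qed.

(** A bound for the norm of unitary matrices. *)
Definition dim2 : R := (n * n)%:R.

Lemma l1norm_unitary U : U \is unitarymx -> l1norm U <= dim2.
Proof.
move=> Uu; rewrite /l1norm /dim2.
apply: (@le_trans _ _ (\sum_(i < n) \sum_(j < n) 1)).
  by apply: ler_sum => i _; apply: ler_sum => j _; exact: unitary_entry_le1.
rewrite sumr_const card_ord sumr_const card_ord.
by rewrite -mulrnA.
Qed.

Lemma dim2_ge0 : 0 <= dim2. Proof. exact: ler0n. Qed.

Lemma l1norm_sandwich U V A : U \is unitarymx -> V \is unitarymx ->
  l1norm (U *m A *m V) <= dim2 ^+ 2 * l1norm A.
Proof.
move=> Uu Vu; apply: le_trans (l1normM _ _) _.
rewrite expr2 mulrAC; apply: ler_pM; rewrite ?l1norm_ge0 ?l1norm_unitary //.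
apply: le_trans (l1normM _ _) _.
by rewrite ler_wpM2r ?l1norm_ge0 ?l1norm_unitary.
Qed.

Lemma l1norm_realdiag d : l1norm (realdiag d) = \sum_i `|d 0 i|.
Proof.
apply: eq_bigr => i _; rewrite (bigD1 i) //= big1 => [|j ji].
  by rewrite !mxE eqxx mulr1n cnorm_real addr0.
by rewrite !mxE eq_sym (negbTE ji) mulr0n (cnorm_real 0) normr0.
Qed.

Lemma l1norm_udiag U d : U \is unitarymx ->
  l1norm (udiag U d) <= dim2 ^+ 2 * \sum_i `|d 0 i|.
Proof.
by move=> Uu; rewrite -l1norm_realdiag; exact: l1norm_sandwich (unitary_adj Uu) Uu.
Qed.

Lemma eigenvalue_le_l1norm U d i : U \is unitarymx ->
  `|d 0 i| <= dim2 ^+ 2 * l1norm (udiag U d).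
Proof.
move=> Uu; have e : realdiag d = U *m udiag U d *m U ^t*.
  rewrite /udiag !mulmxA (unitaryKr Uu) mul1mx -mulmxA (unitaryKr Uu).
  by rewrite mulmx1.
have U'u := unitary_adj Uu.
apply: le_trans (l1norm_sandwich _ Uu U'u); rewrite -e l1norm_realdiag.
by rewrite (bigD1 i) //= lerDl sumr_ge0.
Qed.

(** Between the two eigenbases, the entries of the difference are those of
[udiag U d - udiag V e] with [d 0 j - e 0 i] replaced by
[f (d 0 j) - f (e 0 i)] (see [udiag_entry]). *)
Lemma l1norm_udiagB U V d e f L : U \is unitarymx -> V \is unitarymx ->
  0 <= L -> (forall i j, `|f (d 0 i) - f (e 0 j)| <= L * `|d 0 i - e 0 j|) ->
  l1norm (udiag U (map_mx f d) - udiag V (map_mx f e)) <=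
  dim2 ^+ 2 * (L * (dim2 ^+ 2 * l1norm (udiag U d - udiag V e))).
Proof.
move=> Uu Vu L0 lipf; have U'u := unitary_adj Uu; have V'u := unitary_adj Vu.
have := udiag_entry (map_mx f d) (map_mx f e) Uu Vu.
move: (udiag U (map_mx f d) - udiag V (map_mx f e)) => D eD.
have := udiag_entry d e Uu Vu; move: (udiag U d - udiag V e) => E eE.
have -> : D = V ^t* *m (V *m D *m U ^t*) *m U.
  by rewrite !mulmxA (unitaryKl Vu) mul1mx -mulmxA (unitaryKl Uu) mulmx1.
apply: le_trans (l1norm_sandwich _ V'u Uu) _.
rewrite ler_wpM2l ?exprn_ge0 ?dim2_ge0 //.
apply: (@le_trans _ _ (L * l1norm (V *m E *m U ^t*))).
  rewrite /l1norm mulr_sumr; apply: ler_sum => i _; rewrite mulr_sumr.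
  apply: ler_sum => j _; rewrite eD eE !cnormM !cnorm_real.
  rewrite [map_mx f d 0 j]mxE [map_mx f e 0 i]mxE mulrA.
  by apply: ler_wpM2r; [exact: cnorm_ge0 | exact: lipf].
by rewrite ler_wpM2l //; exact: l1norm_sandwich Vu U'u.
Qed.

End L1Calculus.

(** * Lipschitz families of matrices *)
Section LipschitzFamilies.
Local Opaque geomean mxfun invmx posdefmx.
Variables (R : realType) (T : Type) (D : set T) (dist : T -> T -> R) (n : nat).
Hypothesis dist_ge0 : forall s t, 0 <= dist s t.
Implicit Types (Y Z : T -> 'M[R[i]]_n) (f : R -> R) (P : R -> Prop).

(** Bounded and Lipschitz on [D]; boundedness is included so that products
preserve the notion. *)
Definition lipfam Y := exists2 K : R, 0 <= K & forall s t, D s -> D t ->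
  l1norm (Y s) <= K /\ l1norm (Y s - Y t) <= K * dist s t.

Lemma lipfam_cst (S : 'M[R[i]]_n) : lipfam (fun=> S).
Proof.
exists (l1norm S); first exact: l1norm_ge0.
by move=> s t _ _; rewrite subrr l1norm0 mulr_ge0 ?l1norm_ge0.
Qed.

Lemma lipfamD Y Z : lipfam Y -> lipfam Z -> lipfam (fun t => Y t + Z t).
Proof.
move=> [K K0 hK] [L L0 hL]; exists (K + L); first exact: addr_ge0.
move=> s t Ds Dt; have [h1 h2] := hK _ _ Ds Dt; have [h3 h4] := hL _ _ Ds Dt.
split; first by apply: le_trans (l1normD _ _) _; exact: lerD.
rewrite opprD addrACA mulrDl; apply: le_trans (l1normD _ _) _.
exact: lerD.
Qed.

Lemma lipfam_sum (I : Type) (r : seq I) (F : I -> T -> 'M[R[i]]_n) :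
  (forall i, lipfam (F i)) -> lipfam (fun t => \sum_(i <- r) F i t).
Proof.
move=> hF; elim: r => [|i r IH].
  have [K K0 hK] := lipfam_cst 0; exists K => // s t Ds Dt.
  by rewrite !big_nil; exact: hK Ds Dt.
have [K K0 hK] := lipfamD (hF i) IH; exists K => // s t Ds Dt.
by rewrite !big_cons; exact: hK Ds Dt.
Qed.

Lemma lipfamM Y Z : lipfam Y -> lipfam Z -> lipfam (fun t => Y t *m Z t).
Proof.
move=> [K K0 hK] [L L0 hL]; exists (K * L + (K * L)).
  by rewrite addr_ge0 // mulr_ge0.
move=> s t Ds Dt; have [h1 h2] := hK _ _ Ds Dt; have [h3 h4] := hL _ _ Ds Dt.
split.
  apply: le_trans (l1normM _ _) _; apply: ler_wpDr; first exact: mulr_ge0.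
  by apply: ler_pM => //; exact: l1norm_ge0.
have -> : Y s *m Z s - Y t *m Z t = Y s *m (Z s - Z t) + (Y s - Y t) *m Z t.
  by rewrite mulmxBr mulmxBl addrA subrK.
apply: le_trans (l1normD _ _) _; rewrite mulrDl; apply: lerD.
  apply: le_trans (l1normM _ _) _; rewrite -mulrA.
  by apply: ler_pM => //; exact: l1norm_ge0.
apply: le_trans (l1normM _ _) _; rewrite mulrAC.
by apply: ler_pM; rewrite ?l1norm_ge0 //; exact: (hL _ _ Dt Ds).1.
Qed.

Lemma lipfamZ (a : R) Y : lipfam Y -> lipfam (fun t => a%:C *: Y t).
Proof.
move=> [K K0 hK]; exists (`|a| * K); first exact: mulr_ge0.
move=> s t Ds Dt; have [h1 h2] := hK _ _ Ds Dt.
by rewrite -scalerBr !l1normZ -mulrA; split; apply: ler_wpM2l.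
Qed.

Definition specfam P Y := forall t, D t ->
  exists (U : 'M[R[i]]_n) (d : 'rV[R]_n),
    [/\ U \is unitarymx, forall i, P (d 0 i) & Y t = udiag U d].

Lemma lipfam_mxfun f P (L B : R) Y : 0 <= L -> 0 <= B -> specfam P Y ->
  (forall x y, P x -> P y -> `|f x - f y| <= L * `|x - y|) ->
  (forall x, P x -> `|f x| <= B) ->
  lipfam Y -> lipfam (fun t => mxfun f (Y t)).
Proof.
move=> L0 B0 sY lipf bf [K K0 hK].
pose c : R := dim2 R n ^+ 2; have c0 : 0 <= c by rewrite exprn_ge0 ?dim2_ge0.
exists (c * (n%:R * B) + c * (L * (c * K))).
  by rewrite addr_ge0 // !mulr_ge0.
move=> s t Ds Dt; have [h1 h2] := hK _ _ Ds Dt.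
have [U [d [Uu Pd Ys]]] := sY _ Ds; have [V [e [Vu Pe Yt]]] := sY _ Dt.
have lipde i j : `|f (d 0 i) - f (e 0 j)| <= L * `|d 0 i - e 0 j| by exact: lipf.
have lipfde := l1norm_udiagB Uu Vu L0 lipde.
have bfd := l1norm_udiag (map_mx f d) Uu.
rewrite Ys Yt !(mxfun_udiag _ _ Uu) !(mxfun_udiag _ _ Vu).
rewrite -/c in lipfde bfd; clearbody c; split.
  apply: ler_wpDr; first by rewrite !mulr_ge0.
  apply: le_trans bfd _; apply: ler_wpM2l => //.
  apply: (@le_trans _ _ (\sum_(i < n) B)).
    by apply: ler_sum => i _; rewrite mxE; exact: bf.
  by rewrite sumr_const card_ord -[leLHS]mulr_natl.
apply: le_trans lipfde _.
rewrite mulrDl; apply: ler_wpDl; first by rewrite !mulr_ge0.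
rewrite -!mulrA; apply: ler_wpM2l => //; apply: ler_wpM2l => //.
by apply: ler_wpM2l => //; rewrite -Ys -Yt.
Qed.

(** Lipschitz on compact intervals of positive numbers, the intervals
from [1/c] to [c] being cofinal among them. *)
Definition loclip f := forall c : R, 1 <= c -> exists2 L : R, 0 <= L &
  forall x y, c^-1 <= x <= c -> c^-1 <= y <= c -> `|f x - f y| <= L * `|x - y|.

(** Lipschitz families of positive definite matrices whose spectra stay in a
compact set of positive numbers ([tame_spec]); a bound on the inverses is the
form of this condition that is easy to propagate. *)
Definition tame Y := [/\ forall t, D t -> posdefmx (Y t), lipfam Y &
  exists K : R, forall t, D t -> l1norm (invmx (Y t)) <= K].

Lemma tame_spec Y : tame Y ->
  exists2 c : R, 1 <= c & specfam (fun x => c^-1 <= x <= c) Y.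
Proof.
move=> [pY [K K0 hK] [L hL]]; pose k : R := dim2 R n ^+ 2.
have k0 : 0 <= k by rewrite exprn_ge0 ?dim2_ge0.
exists (1 + k * K + k * `|L|); first by rewrite -addrA lerDl addr_ge0 ?mulr_ge0.
move=> t Dt; have [U [d [Uu d0 Yt]]] := posdefP (pY _ Dt); exists U, d; split=> // i.
have c0 : 0 < 1 + k * K + k * `|L|.
  by rewrite -addrA ltr_pwDl ?addr_ge0 ?mulr_ge0.
have u0 j : d 0 j != 0 by rewrite gt_eqF.
apply/andP; split; last first.
  have := eigenvalue_le_l1norm d i Uu; rewrite (ger0_norm (ltW (d0 i))) => h.
  apply: (le_trans h); rewrite -Yt addrAC; apply: ler_wpDl.
    by rewrite addr_ge0 ?mulr_ge0.
  by apply: ler_wpM2l => //; exact: (hK _ _ Dt Dt).1.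
rewrite -[leRHS]invrK; rewrite lef_pV2 ?posrE ?invr_gt0 //.
have := eigenvalue_le_l1norm (map_mx GRing.inv d) i Uu.
rewrite -(udiag_inv Uu u0).2 -Yt mxE ger0_norm ?invr_ge0 ?(ltW (d0 i)) // => h.
apply: (le_trans h); apply: ler_wpDl; first by rewrite addr_ge0 ?mulr_ge0.
by apply: ler_wpM2l => //; apply: le_trans (ler_norm L); exact: hL.
Qed.

Lemma tame_lipfam_mxfun f Y : loclip f -> tame Y -> lipfam (fun t => mxfun f (Y t)).
Proof.
move=> lf tY; have [c c1 sY] := tame_spec tY; have [L L0 lipf] := lf _ c1.
have c0 : 0 < c by exact: lt_le_trans c1.
have one : c^-1 <= 1 <= c by rewrite c1 invf_le1 // c1.
have [_ lY _] := tY.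
apply: (@lipfam_mxfun f _ L (`|f 1| + L * (c + 1))  _ L0 _ sY lipf _ lY).
  by rewrite addr_ge0 // mulr_ge0 // addr_ge0 // ltW.
move=> x hx; rewrite -[f x](subrK (f 1)) addrC; apply: le_trans (ler_normD _ _) _.
apply: lerD => //; apply: le_trans (lipf _ _ hx one) _; apply: ler_wpM2l => //.
apply: le_trans (ler_normB _ _) _; rewrite normr1 lerD2r.
case/andP: hx => h1 h2; rewrite ger0_norm //.
by apply: le_trans h1; rewrite invr_ge0 ltW.
Qed.

Lemma loclip_ln : loclip (@ln R).
Proof.
move=> c c1; have c0 : 0 < c by exact: lt_le_trans c1.
exists c; first exact: ltW.
have half x y : c^-1 <= x -> c^-1 <= y -> ln x - ln y <= c * `|x - y|.
  move=> cx cy; have ic : 0 < c^-1 by rewrite invr_gt0.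
  have x0 : 0 < x by exact: lt_le_trans cx.
  have y0 : 0 < y by exact: lt_le_trans cy.
  rewrite -ln_div ?posrE // (_ : x / y = 1 + (x - y) / y); last first.
    by rewrite mulrBl divff ?gt_eqF // addrC subrK.
  apply: le_trans (le_ln1Dx _) _.
    by rewrite mulrBl divff ?gt_eqF // ltrBrDl subrr divr_gt0.
  rewrite mulrC; apply: le_trans (ler_norm _) _; rewrite normrM.
  apply: ler_wpM2r => //; rewrite ger0_norm ?invr_ge0 ?(ltW y0) //.
  by rewrite -[leRHS]invrK lef_pV2 ?posrE.
move=> x y /andP[cx _] /andP[cy _]; rewrite ler_norml half // andbT lerNl opprB.
by rewrite distrC half.
Qed.

(** From [1 + h <= exp h] with [h = b - a]. *)
Lemma expR_lip (M x y : R) : x <= M -> y <= M ->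
  `|expR x - expR y| <= expR M * `|x - y|.
Proof.
have half a b : a <= M -> b <= M -> expR a - expR b <= expR M * `|a - b|.
  move=> aM bM; have h : expR a * (1 + (b - a)) <= expR b.
    have -> : expR b = expR a * expR (b - a) by rewrite -expRD addrC subrK.
    by rewrite ler_wpM2l ?expR_ge0 // expR_ge1Dx.
  apply: (@le_trans _ _ (expR a * (a - b))).
    rewrite -subr_ge0 (_ : _ - _ = expR b - expR a * (1 + (b - a))) ?subr_ge0 //.
    by ring.
  apply: (@le_trans _ _ (expR a * `|a - b|)).
    by rewrite ler_wpM2l ?expR_ge0 // ler_norm.
  by rewrite ler_wpM2r // ler_expR.
move=> xM yM; rewrite ler_norml half // andbT lerNl opprB.
by rewrite distrC half.
Qed.

Lemma loclip_powR (a : R) : loclip (fun x => x `^ a).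
Proof.
move=> c c1; have c0 : 0 < c by exact: lt_le_trans c1.
have [L L0 lipln] := loclip_ln c1.
have lnc x : c^-1 <= x <= c -> 0 < x /\ `|ln x| <= ln c.
  move=> /andP[cx xc]; have ic : 0 < c^-1 by rewrite invr_gt0.
  have x0 : 0 < x by exact: lt_le_trans cx.
  split=> //; rewrite ler_norml -lnV ?posrE //.
  by rewrite !ler_ln ?posrE ?cx ?xc.
exists (expR (`|a| * ln c) * (`|a| * L)); first by rewrite !mulr_ge0 ?expR_ge0.
move=> x y hx hy; have [x0 lx] := lnc _ hx; have [y0 ly] := lnc _ hy.
have le_a z : `|ln z| <= ln c -> a * ln z <= `|a| * ln c.
  by move=> h; apply: le_trans (ler_norm _) _; rewrite normrM ler_wpM2l.
rewrite /powR !gt_eqF //; apply: le_trans (expR_lip (le_a _ lx) (le_a _ ly)) _.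
rewrite -!mulrA; apply: ler_wpM2l; first exact: expR_ge0.
rewrite -mulrBr normrM; apply: ler_wpM2l => //.
exact: lipln.
Qed.

Lemma tame_mxpow (a : R) Y : tame Y -> tame (fun t => mxpow (Y t) a).
Proof.
move=> tY; have [pY lY _] := tY.
split; [by move=> t /pY; exact: posdef_mxpow | exact: tame_lipfam_mxfun (loclip_powR a) tY |].
have [K K0 hK] := tame_lipfam_mxfun (loclip_powR (- a)) tY; exists K => t Dt.
have e : mxpow (Y t) a *m mxpow (Y t) (- a) = 1%:M.
  by rewrite (mxpowD _ _ (pY _ Dt)) subrr (mxpow0 (pY _ Dt)).
have [u _] := mulmx1_unit e.
have -> : invmx (mxpow (Y t) a) = mxpow (Y t) (- a).
  by rewrite -[RHS](mulKmx u) e mulmx1.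
exact: (hK _ _ Dt Dt).1.
Qed.

Lemma tame_congr (S : 'M[R[i]]_n) Y : posdefmx S -> tame Y ->
  tame (fun t => S *m Y t *m S).
Proof.
move=> pS [pY lY [K hK]]; split.
- by move=> t /pY h; exact: posdef_congr_herm h pS.
- by apply: lipfamM; [apply: lipfamM => // |]; exact: lipfam_cst.
exists (l1norm (invmx S) * K * l1norm (invmx S)) => t Dt.
have Su := posdef_unit pS; have Yu := posdef_unit (pY _ Dt).
have -> : invmx (S *m Y t *m S) = invmx S *m invmx (Y t) *m invmx S.
  have e : invmx S *m invmx (Y t) *m invmx S *m (S *m Y t *m S) = 1%:M.
    by rewrite -!mulmxA (mulKmx Su) (mulKmx Yu) (mulVmx Su).
  have pC := posdef_unit (posdef_congr_herm (pY _ Dt) pS).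
  by rewrite -[RHS](mulmxK pC) e mul1mx.
apply: le_trans (l1normM _ _) _; apply: ler_wpM2r; first exact: l1norm_ge0.
apply: le_trans (l1normM _ _) _; apply: ler_wpM2l; first exact: l1norm_ge0.
exact: hK.
Qed.

Lemma tame_geomean (A : 'M[R[i]]_n) Y : posdefmx A -> tame Y ->
  tame (fun t => geomean A (Y t)).
Proof.
move=> pA tY; have pk := posdef_mxpow (- 2^-1) pA.
have ph := posdef_mxpow 2^-1 pA.
exact: tame_congr ph (tame_mxpow 2^-1 (tame_congr pk tY)).
Qed.

Lemma tame_exp (H : T -> 'M[R[i]]_n) : (forall t, D t -> H t \is hermsymmx) ->
  lipfam H -> tame (fun t => mxfun expR (H t)).
Proof.
move=> hH lH; have [K K0 hK] := lH; pose c := dim2 R n ^+ 2 * K.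
have sH : specfam (fun x => `|x| <= c) H.
  move=> t Dt; have [U [d [Uu Ht]]] := hermE (hH _ Dt); exists U, d; split=> // i.
  apply: le_trans (eigenvalue_le_l1norm _ _ Uu) _; rewrite -Ht.
  by apply: ler_wpM2l; [rewrite exprn_ge0 ?dim2_ge0 | exact: (hK _ _ Dt Dt).1].
have lipe : lipfam (fun t => mxfun expR (H t)).
  apply: (@lipfam_mxfun expR _ (expR c) (expR c) _ _ _ sH) => //.
  - exact: expR_ge0.
  - exact: expR_ge0.
  - by move=> x y hx hy; apply: expR_lip; apply: le_trans (ler_norm _) _.
  - by move=> x hx; rewrite ger0_norm ?expR_ge0 // ler_expR (le_trans (ler_norm _)).
have [L L0 hL] : lipfam (fun t => mxfun (fun x => expR (- x)) (H t)).
  apply: (@lipfam_mxfun _ _ (expR c) (expR c) _ _ _ sH) => //.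
  - exact: expR_ge0.
  - exact: expR_ge0.
  - move=> x y hx hy; have -> : `|x - y| = `|(- x) - (- y)| by rewrite opprK [in RHS]addrC distrC.
    by apply: expR_lip; apply: le_trans (ler_norm _) _; rewrite normrN.
  - move=> x hx; rewrite ger0_norm ?expR_ge0 // ler_expR (le_trans (ler_norm _)) //.
    by rewrite normrN.
split=> //.
  move=> t /hH /hermE[U [d [Uu ->]]]; rewrite (mxfun_udiag _ _ Uu).
  by apply/(udiag_posdef _ Uu) => i; rewrite mxE expR_gt0.
exists L => t Dt; have [h _] := hL _ _ Dt Dt; apply: le_trans h.
have [U [d [Uu ->]]] := hermE (hH _ Dt); rewrite !(mxfun_udiag _ _ Uu).
have u0 i : map_mx expR d 0 i != 0 by rewrite mxE gt_eqF ?expR_gt0.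
rewrite (udiag_inv Uu u0).2 -map_mx_comp.
suff -> : map_mx (GRing.inv \o expR) d = map_mx (fun x => expR (- x)) d by [].
by apply/rowP => i; rewrite !mxE /= expRN.
Qed.

End LipschitzFamilies.

(** * Coercivity of the logarithm of the geometric mean *)
Section Coercivity.
Local Opaque geomean mxfun invmx posdefmx.
Variables (R : realType) (n : nat).
Implicit Types (A B S T U V X G : 'M[R[i]]_n) (d e : 'rV[R]_n).

Lemma unitary_col_sum U j : U \is unitarymx -> \sum_i cnorm (U i j) ^+ 2 = 1.
Proof.
move=> Uu; rewrite -(unitary_row_sum j (unitary_adj Uu)).
by apply: eq_bigr => i _; congr (_ ^+ 2); rewrite !mxE; exact/esym/cnorm_conj.
Qed.

Lemma udiag_diag_entry U d j :
  complex.Re (udiag U d j j) = \sum_i d 0 i * cnorm (U i j) ^+ 2.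
Proof.
rewrite /udiag /realdiag mul_mx_diag mxE Re_sum; apply: eq_bigr => i _.
rewrite !mxE mulrAC mulrC.
have -> : Num.conj (U i j) * U i j = (cnorm (U i j) ^+ 2)%:C.
  by rewrite cnorm_sqr normCK mulrC.
by rewrite ReZ.
Qed.

Lemma posdef_diag_gt0 S j : posdefmx S -> 0 < complex.Re (S j j).
Proof.
move=> /posdefP[V [d [Vu d0 ->]]]; rewrite udiag_diag_entry.
have ge0 i : 0 <= d 0 i * cnorm (V i j) ^+ 2.
  by rewrite mulr_ge0 ?exprn_ge0 ?cnorm_ge0 // ltW.
rewrite lt_def sumr_ge0 // andbT psumr_eq0 //; apply/negP => /allP h.
have := unitary_col_sum j Vu; rewrite big1 => [/eqP|i _].
  by rewrite eq_sym oner_eq0.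
have := h i; rewrite mem_index_enum => /(_ isT); rewrite /= mulf_eq0 gt_eqF //=.
by move/eqP.
Qed.

(** Jensen's inequality: the squared moduli in a column of the diagonalizing
unitary matrix are weights, and [ln] lies below its tangent at the weighted mean
[s] of the eigenvalues. *)
Lemma log_diag_le S j : posdefmx S ->
  complex.Re (mxlog S j j) <= ln (complex.Re (S j j)).
Proof.
move=> pS; have s0 := posdef_diag_gt0 j pS.
have [V [d [Vu d0 eS]]] := posdefP pS.
have es : complex.Re (S j j) = \sum_i d 0 i * cnorm (V i j) ^+ 2.
  by rewrite eS udiag_diag_entry.
rewrite {1}eS /mxlog (mxfun_udiag _ _ Vu) udiag_diag_entry.
move: (complex.Re (S j j)) s0 es => s s0 es.
apply: (@le_trans _ _ (\sum_i (d 0 i / s - 1 + ln s) * cnorm (V i j) ^+ 2)).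
  apply: ler_sum => i _; rewrite mxE ler_wpM2r ?exprn_ge0 ?cnorm_ge0 //.
  have ds : 0 < d 0 i / s by rewrite divr_gt0.
  rewrite -lerBlDr -ln_div ?posrE //.
  have -> : d 0 i / s = 1 + (d 0 i / s - 1) by rewrite addrC subrK.
  rewrite [X in _ <= X](_ : _ = d 0 i / s - 1); last by rewrite addrAC subrr add0r.
  by apply: le_ln1Dx; rewrite ltrBrDl subrr.
under eq_bigr do rewrite mulrDl mulrBl mulrAC mul1r.
rewrite big_split sumrB /= -mulr_suml -es -mulr_sumr unitary_col_sum //.
by rewrite divff ?gt_eqF // subrr add0r mulr1.
Qed.

(** Keep only the term [k = j] of the sum over [k] of [d k * |S j k|^2]. *)
Lemma riccati_diag_le S d j : S \is hermsymmx -> (forall i, 0 < d 0 i) ->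
  complex.Re (S j j) ^+ 2 * d 0 j <= complex.Re ((S *m realdiag d *m S) j j).
Proof.
move=> /hermP hS d0.
have Sherm a b : S a b = Num.conj (S b a) by rewrite -{1}hS !mxE.
have -> : complex.Re ((S *m realdiag d *m S) j j) = \sum_k d 0 k * cnorm (S j k) ^+ 2.
  rewrite /realdiag mul_mx_diag mxE Re_sum; apply: eq_bigr => k _.
  rewrite !mxE (Sherm k j) mulrAC mulrC.
  have -> : S j k * Num.conj (S j k) = (cnorm (S j k) ^+ 2)%:C.
    by rewrite cnorm_sqr normCK.
  by rewrite ReZ.
rewrite (bigD1 j) //= mulrC; apply: ler_wpDr.
  by apply: sumr_ge0 => k _; rewrite mulr_ge0 ?exprn_ge0 ?cnorm_ge0 // ltW.
rewrite ler_wpM2l ?(ltW (d0 j)) //.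
by rewrite -[X in X <= _]real_normK ?num_real // lerXn2r ?nnegrE ?cnorm_ge0 ?le_Re_cnorm.
Qed.

Lemma posdef_conj_diag_bound A : posdefmx A -> exists2 c : R, 0 < c &
  forall U j, U \is unitarymx -> complex.Re ((U *m A *m U ^t*) j j) <= c.
Proof.
move=> /posdefP[W [a [Wu a0 ->]]]; exists (1 + \sum_i a 0 i).
  by rewrite ltr_pwDl // sumr_ge0 // => i _; exact: ltW.
move=> U j Uu; rewrite udiag_conj udiag_diag_entry; apply: ler_wpDl => //.
apply: ler_sum => i _; rewrite ler_piMr ?(ltW (a0 i)) //.
have UWu := mul_unitarymx Wu (unitary_adj Uu).
by rewrite expr_le1 ?cnorm_ge0 //; exact: unitary_entry_le1 i j UWu.
Qed.

Lemma posdef_udiag_expR U d : U \is unitarymx -> posdefmx (udiag U (map_mx expR d)).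
Proof. by move=> Uu; apply/(udiag_posdef _ Uu) => i; rewrite mxE expR_gt0. Qed.

Lemma invmx_udiag_expR U d : U \is unitarymx ->
  invmx (udiag U (map_mx expR d)) = udiag U (map_mx expR (- d)).
Proof.
move=> Uu; have u0 i : map_mx expR d 0 i != 0 by rewrite mxE gt_eqF ?expR_gt0.
rewrite (udiag_inv Uu u0).2 -map_mx_comp.
suff -> : map_mx (GRing.inv \o expR) d = map_mx expR (- d) by [].
by apply/rowP => i; rewrite !mxE /= expRN.
Qed.

(** In an eigenbasis of [X = exp (- d)], the Riccati equation for
[T = geomean A (invmx X)] bounds [(T j j)^2 exp (- d j)] by the diagonal entry
of [A], and [log_diag_le] transfers the bound to [log T]. *)
Lemma log_geomean_le A : posdefmx A -> exists2 c : R, 0 <= c &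
  forall U d j, U \is unitarymx ->
  complex.Re ((U *m mxlog (geomean A (udiag U (map_mx expR d))) *m U ^t*) j j)
    <= d 0 j / 2 + c.
Proof.
move=> pA; have [a a0 Aa] := posdef_conj_diag_bound pA.
exists (`|ln a| / 2); first by rewrite divr_ge0.
move=> U d j Uu; pose X := udiag U (map_mx expR (- d)).
have pX : posdefmx X := posdef_udiag_expR (- d) Uu.
have iX : udiag U (map_mx expR d) = invmx X.
  by rewrite /X (invmx_udiag_expR _ Uu) opprK.
rewrite iX; have pT := geomean_posdef pA (posdef_inv pX).
have eA := geomean_riccati pA pX.
move: (geomean A (invmx X)) pT eA => T pT eA.
rewrite /mxlog -(mxfun_conj _ Uu (posdef_herm pT)) -/(mxlog _).
have pS := posdef_unitary_conj Uu pT.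
have SS : (U *m T *m U ^t*) *m realdiag (map_mx expR (- d)) *m (U *m T *m U ^t*) =
    U *m A *m U ^t*.
  by rewrite -eA /X /udiag !mulmxA.
move: (U *m T *m U ^t*) pS SS => S pS SS.
apply: le_trans (log_diag_le j pS) _.
have e0 i : 0 < map_mx expR (- d) 0 i by rewrite mxE expR_gt0.
have := riccati_diag_le j (posdef_herm pS) e0; rewrite SS => h.
have {h} := le_trans h (Aa U j Uu).
have s0 := posdef_diag_gt0 j pS.
move: (complex.Re (S j j)) s0 => s s0; rewrite !mxE.
rewrite -ler_ln ?posrE ?mulr_gt0 ?exprn_gt0 ?expR_gt0 //.
rewrite lnM ?posrE ?exprn_gt0 ?expR_gt0 // lnXn // expRK.
have := ler_norm (ln a); lra.
Qed.

(** The lower bound is the upper bound for the inverses, since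
[geomean (invmx A) (invmx B)] is the inverse of [geomean A B]. *)
Lemma log_geomean_coercive A : posdefmx A -> exists2 c : R, 0 <= c &
  forall U d j, U \is unitarymx ->
  `|complex.Re ((U *m mxlog (geomean A (udiag U (map_mx expR d))) *m U ^t*) j j)
    - d 0 j / 2| <= c.
Proof.
move=> pA; have [a a0 ha] := log_geomean_le pA.
have [b b0 hb] := log_geomean_le (posdef_inv pA).
exists (a + b); first exact: addr_ge0.
move=> U d j Uu; have h1 := ha U d j Uu; have := hb U (- d) j Uu.
have pX := posdef_udiag_expR (- d) Uu.
have pE := posdef_udiag_expR d Uu.
have iX : udiag U (map_mx expR d) = invmx (udiag U (map_mx expR (- d))).
  by rewrite (invmx_udiag_expR _ Uu) opprK.
have iE : udiag U (map_mx expR (- d)) = invmx (invmx (udiag U (map_mx expR (- d)))).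
  by rewrite invmxK.
rewrite iE (geomean_inv pA pX) -iX (mxlog_inv (geomean_posdef pA pE)).
move: (mxlog _) h1 => L h1; rewrite mulmxN mulNmx [in X in X -> _]mxE ReN [(- d) 0 j]mxE => h2.
rewrite ler_norml; apply/andP; split; lra.
Qed.

End Coercivity.

(** * Existence of a solution *)
Section Existence.
Local Opaque geomean mxfun invmx posdefmx.
Variables (R : realType) (n m : nat).
Variables (w : 'I_m -> R) (A : 'I_m -> 'M[R[i]]_n).
Hypothesis n0 : (0 < n)%N.
Hypothesis hw : prob_weights w.
Hypothesis pA : forall i, posdefmx (A i).
Implicit Types (G U V : 'M[R[i]]_n) (d : 'rV[R]_n).

Definition logsum G := \sum_i (w i)%:C *: mxlog (geomean (A i) (mxfun expR G)).

Lemma posdef_mxexp G : G \is hermsymmx -> posdefmx (mxfun expR G).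
Proof.
move=> /hermE[U [d [Uu ->]]]; rewrite (mxfun_udiag _ _ Uu).
exact: posdef_udiag_expR.
Qed.

Lemma mxlog_herm (B : 'M[R[i]]_n) : posdefmx B -> mxlog B \is hermsymmx.
Proof.
move=> /posdefP[U [d [Uu _ ->]]]; rewrite /mxlog (mxfun_udiag _ _ Uu).
exact: udiag_hermsym.
Qed.

Lemma realZ_herm (a : R) (B : 'M[R[i]]_n) : B ^t* = B -> (a%:C *: B) ^t* = a%:C *: B.
Proof.
move=> hB; rewrite linearZ /= map_mxZ hB; congr (_ *: _); exact: conj_realC.
Qed.

Lemma logsum_herm G : G \is hermsymmx -> logsum G \is hermsymmx.
Proof.
move=> hG; apply/hermP; rewrite /logsum raddf_sum map_mx_sum; apply: eq_bigr => i _.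
have /hermP hL := mxlog_herm (geomean_posdef (pA i) (posdef_mxexp hG)).
exact: realZ_herm.
Qed.

Lemma logsum_coercive : exists2 c : R, 0 <= c & forall U d j, U \is unitarymx ->
  `|complex.Re ((U *m logsum (udiag U d) *m U ^t*) j j) - d 0 j / 2| <= c.
Proof.
have [w0 sw] := hw.
have [c hc] := choice (fun i => let: ex_intro2 c h1 h2 := log_geomean_coercive (pA i) in
  ex_intro (fun c : R => 0 <= c /\ forall U d j, U \is unitarymx ->
  `|complex.Re ((U *m mxlog (geomean (A i) (udiag U (map_mx expR d))) *m U ^t*) j j)
    - d 0 j / 2| <= c) c (conj h1 h2)).
exists (\sum_i w i * c i).
  by apply: sumr_ge0 => i _; rewrite mulr_ge0 ?(ltW (w0 i)) // (hc i).1.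
move=> U d j Uu.
have -> : complex.Re ((U *m logsum (udiag U d) *m U ^t*) j j) = \sum_i w i *
    complex.Re ((U *m mxlog (geomean (A i) (udiag U (map_mx expR d))) *m U ^t*) j j).
  rewrite /logsum mulmx_sumr mulmx_suml summxE Re_sum; apply: eq_bigr => i _.
  by rewrite -scalemxAr -scalemxAl mxE ReZ (mxfun_udiag _ _ Uu).
have -> : d 0 j / 2 = \sum_i w i * (d 0 j / 2) by rewrite -mulr_suml sw mul1r.
rewrite -sumrB.
apply: le_trans (ler_norm_sum _ _ _) _; apply: ler_sum => i _.
rewrite -mulrBr normrM ger0_norm ?(ltW (w0 i)) // ler_wpM2l ?(ltW (w0 i)) //.
exact: ((hc i).2 U d j Uu).
Qed.

Lemma trace_udiag_mul U d (F : 'M[R[i]]_n) : complex.Re (\tr (F *m udiag U d)) =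
  \sum_j d 0 j * complex.Re ((U *m F *m U ^t*) j j).
Proof.
rewrite /udiag mulmxA mxtrace_mulC !mulmxA.
rewrite /realdiag mul_mx_diag /mxtrace Re_sum; apply: eq_bigr => j _.
by rewrite mxE [map_mx _ _ _ _]mxE mulrC ReZ.
Qed.

(** The trace is the sum of the eigenvalues [x] of [G] times diagonal entries [f]
with [|f - x / 2| <= c]; each term is at least [x^2 / 4 - c^2]. *)
Lemma logsum_bounded : exists2 r : R, 0 <= r & forall G, G \is hermsymmx ->
  complex.Re (\tr (logsum G *m G)) <= 0 -> l1norm G <= r.
Proof.
have [c c0 hc] := logsum_coercive.
exists (dim2 R n ^+ 2 * (n%:R * (2 * n%:R * c))).
  by rewrite !mulr_ge0 ?exprn_ge0 ?dim2_ge0.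
move=> G /hermE[U [d [Uu ->]]]; rewrite trace_udiag_mul => tr0.
have sd : \sum_j d 0 j ^+ 2 <= 4 * n%:R * c ^+ 2.
  have : \sum_j (d 0 j ^+ 2 / 4 - c ^+ 2) <= 0.
    apply: le_trans tr0; apply: ler_sum => j _.
    have := hc U d j Uu; move: (complex.Re _) (d 0 j) => f x.
    rewrite ler_norml => /andP[h1 h2].
    have [x0|x0] := leP 0 x.
      have := ler_wpM2l x0 h1; have := sqr_ge0 (x / 2 - c); nra.
    have := ler_wpM2l (ltW (_ : 0 < - x)) h2; rewrite oppr_gt0 => /(_ x0).
    have := sqr_ge0 (x / 2 + c); nra.
  rewrite sumrB -mulr_suml sumr_const card_ord -[c ^+ 2 *+ n]mulr_natl; lra.
apply: le_trans (l1norm_udiag _ Uu) _.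
rewrite ler_wpM2l ?exprn_ge0 ?dim2_ge0 //.
apply: (@le_trans _ _ (\sum_(j < n) (2 * n%:R * c))); last first.
  by rewrite sumr_const card_ord -[leLHS]mulr_natl.
apply: ler_sum => j _.
have n1 : 1 <= n%:R :> R by rewrite ler1n.
have nc0 : 0 <= 2 * n%:R * c by rewrite !mulr_ge0.
rewrite -(@ler_pXn2r _ 2) ?nnegrE // real_normK ?num_real //.
apply: (@le_trans _ _ (\sum_j d 0 j ^+ 2)).
  by rewrite (bigD1 j) //= lerDl sumr_ge0 // => k _; exact: sqr_ge0.
apply: le_trans sd _.
have -> : (2 * n%:R * c) ^+ 2 = 4 * n%:R * c ^+ 2 * n%:R by ring.
by rewrite ler_peMr // !mulr_ge0 // sqr_ge0.
Qed.

Let index := (bool * bool * 'I_n * 'I_n)%type.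

(** [M] times a real spanning family of the hermitian matrices, with both signs;
[s] is the sign and [b] selects the real or the imaginary part. *)
Definition vertex (M : R) (p : index) : 'M[R[i]]_n :=
  let: (s, b, j, k) := p in (((-1) ^+ s * M)%:C) *:
    (if b then delta_mx j k + delta_mx k j
     else 'i *: delta_mx j k - 'i *: delta_mx k j).

Lemma vertex_herm M p : vertex M p ^t* = vertex M p.
Proof.
move: p => [[[s b] j] k]; apply: realZ_herm.
case: b; apply/matrixP => x y; rewrite !mxE.
  by rewrite rmorphD /= !rmorph_nat addrC ![(y == _) && _]andbC.
rewrite rmorphB /= !rmorphM /= !rmorph_nat.
have -> : Num.conj ('i : R[i]) = - 'i.
  by apply/eqP; rewrite eq_complex /= oppr0 !eqxx.
by rewrite !mulNr opprK addrC ![(y == _) && _]andbC.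
Qed.

Lemma Re_trN (X : 'M[R[i]]_n) : complex.Re (\tr (- X)) = - complex.Re (\tr X).
Proof. by rewrite [\tr _]raddfN ReN. Qed.

Lemma Re_trB (X Y : 'M[R[i]]_n) :
  complex.Re (\tr (X - Y)) = complex.Re (\tr X) - complex.Re (\tr Y).
Proof. by rewrite mxtraceD ReD Re_trN. Qed.

Lemma Re_tr_sum (I : Type) (q : seq I) (F : I -> 'M[R[i]]_n) :
  complex.Re (\tr (\sum_(i <- q) F i)) = \sum_(i <- q) complex.Re (\tr (F i)).
Proof.
by elim/big_rec2: _ => [|i x X _ <-]; rewrite ?mxtrace0 // mxtraceD ReD.
Qed.

Lemma trace_delta (F : 'M[R[i]]_n) j k : \tr (F *m delta_mx j k) = F k j.
Proof.
rewrite /mxtrace (bigD1 k) //= mxE (bigD1 j) //= !mxE !eqxx mulr1.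
rewrite !big1 ?addr0 // => [l /negbTE lk|l /negbTE lj].
  by rewrite mxE big1 // => l' _; rewrite !mxE lk andbF mulr0.
by rewrite !mxE lj mulr0.
Qed.

Lemma Re_trace_vertex M (F : 'M[R[i]]_n) s b j k : F ^t* = F ->
  complex.Re (\tr (F *m vertex M (s, b, j, k))) =
  (-1) ^+ s * M * (2 * (if b then complex.Re (F k j) else - complex.Im (F k j))).
Proof.
move=> hF; have Fherm x y : F x y = Num.conj (F y x) by rewrite -{1}hF !mxE.
rewrite /vertex -scalemxAr mxtraceZ ReZ; congr (_ * _); case: b.
  rewrite mulmxDr mxtraceD !trace_delta ReD (Fherm j k).
  by case: (F k j) => x y /=; rewrite mulr2n mulrDl mul1r.
have -> : F *m ('i *: delta_mx j k - 'i *: delta_mx k j) =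
    'i *: (F *m delta_mx j k) - 'i *: (F *m delta_mx k j).
  by rewrite mulmxBr -!scalemxAr.
rewrite [\tr _]raddfB /= !mxtraceZ !trace_delta (Fherm j k).
by case: (F k j) => x y /=; ring.
Qed.

Lemma vertex_bound (M c : R) (F : 'M[R[i]]_n) : 0 < M -> F ^t* = F ->
  (forall p, complex.Re (\tr (F *m vertex M p)) <= c) ->
  l1norm F <= dim2 R n * (c / M).
Proof.
move=> M0 hF Fc.
have bd b j k : 2 * `|if b then complex.Re (F k j) else - complex.Im (F k j)| <= c / M.
  have := Fc (true, b, j, k); have := Fc (false, b, j, k).
  rewrite !(Re_trace_vertex _ _ _ _ _ hF) expr0 expr1 mul1r mulN1r mulNr.
  move: (if b then _ else _) => x h1 h2; rewrite ler_pdivlMr //.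
  rewrite mulrC mulrCA; have [x0|x0] := leP 0 x; rewrite ?(ger0_norm x0) ?(ltr0_norm x0) //; nra.
rewrite /l1norm /dim2 natrM -mulrA.
apply: (@le_trans _ _ (\sum_(i < n) \sum_(j < n) (c / M))).
  apply: ler_sum => k _; apply: ler_sum => j _; apply: le_trans (cnorm_le_ReIm _) _.
  have := bd true j k; have := bd false j k; rewrite normrN; lra.
by rewrite !sumr_const !card_ord -[leLHS]mulr_natl -[c / M *+ n]mulr_natl.
Qed.

(** [M] exceeds [dim2 * r], where [r] bounds the solutions of the variational
inequality: then [M * l1norm F <= dim2 * r * l1norm F] leaves only [F = 0]. *)
Lemma Gamma_nonempty : exists X, Gamma w A X.
Proof.
have [r r0 hr] := logsum_bounded.
pose M := dim2 R n * r + 1.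
have M0 : 0 < M by rewrite ltr_wpDl // mulr_ge0 ?dim2_ge0.
pose N := #|{: index}|.
have N0 : (0 < N)%N.
  by apply/card_gt0P; exists (true, true, Ordinal n0, Ordinal n0).
pose V (i : 'I_N) := vertex M (enum_val i).
pose G (t : 'rV[R]_N) := \sum_i (t 0 i)%:C *: V i.
have hG t : G t \is hermsymmx.
  apply/hermP; rewrite /G raddf_sum map_mx_sum; apply: eq_bigr => i _.
  by apply: realZ_herm; exact: vertex_herm.
pose K0 := \sum_i l1norm (V i).
have V0 i : l1norm (V i) <= K0.
  by rewrite /K0 (bigD1 i) //= lerDl sumr_ge0 // => *; exact: l1norm_ge0.
have lipG : lipfam (@simplex R N) (@dist1 R N) G.
  exists K0; first by apply: sumr_ge0 => *; exact: l1norm_ge0.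
  move=> s t sS tS; split.
    apply: le_trans (l1norm_sum _ _ _) _; apply: ler_sum => i _.
    by rewrite l1normZ ger0_norm ?(sS.1 i) // ler_piMl ?l1norm_ge0 // simplex_le1.
  rewrite /G -sumrB; apply: le_trans (l1norm_sum _ _ _) _.
  rewrite /dist1 mulr_sumr; apply: ler_sum => i _.
  rewrite -scalerBl -rmorphB /= l1normZ [leRHS]mulrC; apply: ler_wpM2l => //; exact: V0.
have d0 := @dist1_ge0 R N.
have lipF : lipfam (@simplex R N) (@dist1 R N) (fun t => logsum (G t)).
  apply: (lipfam_sum d0) => j; apply: lipfamZ.
  have h1 := tame_exp d0 (fun t _ => hG t) lipG.
  have h2 := tame_geomean d0 (pA j) h1.
  have h3 := tame_lipfam_mxfun d0 (@loclip_ln R) h2.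
  exact: h3.
have vertexG i : exists K : R, 0 <= K /\ forall s t, simplex s -> simplex t ->
    l1norm (logsum (G s) *m (G s - V i)) <= K /\
    l1norm (logsum (G s) *m (G s - V i) - logsum (G t) *m (G t - V i)) <=
      K * dist1 s t.
  suff [K Kge hK] : lipfam (@simplex R N) (@dist1 R N)
    (fun t => logsum (G t) *m (G t - V i)) by exists K.
  exact: lipfamM lipF (lipfamD lipG (lipfam_cst _ d0 (- V i))).
have [K hK] := choice vertexG.
pose phi (i : 'I_N) (t : 'rV[R]_N) := complex.Re (\tr (logsum (G t) *m (G t - V i))).
have Kle i : K i <= \sum_j K j.
  by rewrite (bigD1 i) //= lerDl sumr_ge0 // => j _; exact: (hK j).1.
have [| | |t tS ht] := @simplex_variational R N phi (\sum_i K i) N0.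
- move=> i s t sS tS; rewrite /phi -Re_trB.
  apply: le_trans (Re_tr_l1norm _) _; apply: le_trans ((hK i).2 _ _ sS tS).2 _.
  by apply: ler_wpM2r; [exact: dist1_ge0 | exact: Kle].
- move=> i t tS; apply: le_trans (Re_tr_l1norm _) _.
  exact: le_trans ((hK i).2 _ _ tS tS).1 (Kle i).
- move=> t tS; rewrite /phi.
  transitivity (complex.Re (\tr (logsum (G t) *m \sum_i (t 0 i)%:C *: (G t - V i)))).
    rewrite mulmx_sumr Re_tr_sum; apply: eq_bigr => i _.
    by rewrite -scalemxAr mxtraceZ ReZ.
  have -> : \sum_i (t 0 i)%:C *: (G t - V i) = 0.
    under eq_bigr do rewrite scalerBr.
    by rewrite sumrB -scaler_suml -rmorph_sum /= tS.2 scale1r subrr.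
  by rewrite mulmx0 mxtrace0.
exists (invmx (mxfun expR (G t))); apply/GammaE.
split; first exact: posdef_inv (posdef_mxexp (hG t)).
have hF := (hermP _).1 (logsum_herm (hG t)).
pose c := - complex.Re (\tr (logsum (G t) *m G t)).
have Fc p : complex.Re (\tr (- logsum (G t) *m vertex M p)) <= c.
  have := ht (enum_rank p); rewrite /phi /V enum_rankK mulmxBr.
  rewrite Re_trB mulNmx Re_trN /c; lra.
have hNF : (- logsum (G t)) ^t* = - logsum (G t).
  by rewrite raddfN /= map_mxN hF.
have bF := vertex_bound M0 hNF Fc.
have c0 : 0 <= c.
  have := Fc (true, true, Ordinal n0, Ordinal n0).
  have := Fc (false, true, Ordinal n0, Ordinal n0).
  rewrite !(Re_trace_vertex _ _ _ _ _ hNF) expr0 expr1; lra.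
have lG : l1norm (G t) <= r by apply: hr => //; rewrite -oppr_ge0.
have cle : c <= l1norm (logsum (G t)) * r.
  apply: le_trans (ler_norm _) _; rewrite /c normrN.
  apply: le_trans (Re_tr_l1norm _) _; apply: le_trans (l1normM _ _) _.
  by rewrite ler_wpM2l ?l1norm_ge0.
suff F0 : logsum (G t) = 0 by move: F0; rewrite /logsum invmxK.
apply: l1norm_eq0; rewrite l1normN in bF.
move: (l1norm (logsum (G t))) (l1norm_ge0 (logsum (G t))) bF cle => l l0 bF cle.
have h : l * M <= dim2 R n * c.
  by rewrite -ler_pdivlMr // -mulrA.
have := ler_wpM2l (dim2_ge0 R n) cle; move: h; rewrite /M; nra.
Qed.

End Existence.

Theorem theorem3p1 (R : realType) (n m : nat) (hn : (0 < n)%N)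
    (w : 'I_m -> R) (A : 'I_m -> 'M[R[i]]_n)
    (hw : prob_weights w) (hA : forall i, posdefmx (A i)) :
  ((forall i j, A i *m A j = A j *m A i) ->
     [set \big[mulmx/1%:M]_(i < m) mxpow (A i) (w i)] `<=` Gamma w A) /\
  (forall alpha : R, 0 < alpha ->
     Gamma w (fun i => alpha%:C *: A i) =
     [set alpha%:C *: X | X in Gamma w A]) /\
  (forall s : 'S_m,
     Gamma (fun i => w (s i)) (fun i => A (s i)) = Gamma w A) /\
  (forall k : nat, (0 < k)%N ->
     Gamma (repeat_weights (k := k) w) (repeat_tuple (k := k) A) = Gamma w A) /\
  (forall U : 'M[R[i]]_n, U \is unitarymx ->
     Gamma w (fun i => U *m A i *m U ^t*) =
     [set U *m X *m U ^t* | X in Gamma w A]) /\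
  Gamma w (fun i => invmx (A i)) = [set invmx X | X in Gamma w A] /\
  [set \det X | X in Gamma w A] =
  [set \prod_(i < m) ((complex.Re (\det (A i))) `^ (w i))%:C].
Proof.
have [w0 sw] := hw.
split; first by move=> cA _ ->; exact: Gamma_commuting hw hA cA.
split.
  move=> alpha a0; apply/seteqP; split=> [X hX|_ [X hX <-]]; last exact: Gamma_scale a0 hA hX.
  have pA' i : posdefmx (alpha%:C *: A i) := posdef_scale a0 (hA i).
  have a'0 : 0 < alpha^-1 by rewrite invr_gt0.
  have aa : alpha%:C * (alpha^-1)%:C = 1 by rewrite -rmorphM /= divff ?gt_eqF.
  have := Gamma_scale a'0 pA' hX.
  have -> : (fun i => (alpha^-1)%:C *: (alpha%:C *: A i)) = A.
    by apply/funext => i; rewrite scalerA mulrC aa scale1r.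
  by move=> h; exists ((alpha^-1)%:C *: X) => //; rewrite scalerA aa scale1r.
split; first exact: Gamma_perm.
split; first by move=> k k0; exact: Gamma_repeat.
split.
  move=> U Uu; apply/seteqP; split=> [X hX|_ [X hX <-]]; last exact: Gamma_unitary Uu hA hX.
  have pA' i : posdefmx (U *m A i *m U ^t*) := posdef_unitary_conj Uu (hA i).
  have U'u := unitary_adj Uu; have := Gamma_unitary U'u pA' hX.
  have UK (B : 'M[R[i]]_n) : U ^t* *m (U *m B *m U ^t*) *m U ^t* ^t* = B.
    by rewrite trmxCK !mulmxA (unitaryKl Uu) mul1mx -mulmxA (unitaryKl Uu) mulmx1.
  have -> : (fun i => U ^t* *m (U *m A i *m U ^t*) *m U ^t* ^t*) = A.
    by apply/funext => i; exact: UK.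
  move=> h; exists (U ^t* *m X *m U ^t* ^t*) => //.
  by rewrite trmxCK !mulmxA (unitaryKr Uu) mul1mx -mulmxA (unitaryKr Uu) mulmx1.
split.
  apply/seteqP; split=> [X hX|_ [X hX <-]]; last exact: Gamma_inv hA hX.
  have pA' i : posdefmx (invmx (A i)) := posdef_inv (hA i).
  have := Gamma_inv pA' hX.
  have -> : (fun i => invmx (invmx (A i))) = A.
    by apply/funext => i; exact: invmxK.
  by move=> h; exists (invmx X) => //; exact: invmxK.
have [X0 hX0] := Gamma_nonempty hn hw hA.
apply/seteqP; split=> [_ [X hX <-]|_ ->]; first exact: Gamma_det hw hA hX.
by exists X0; [exact: hX0 | exact: Gamma_det hw hA hX0].
Qed.
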